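(* Let $\mathcal{X}\subseteq\mathbb{R}^m$ and $\mathcal{Y}\subseteq\mathbb{R}^n$ be nonempty polytopes, $\mathcal{Z}=\mathcal{X}\times\mathcal{Y}$, $A\in\mathbb{R}^{m\times n}$. Let $\alpha>0$ be a constant, depending only on $(A,\mathcal{X},\mathcal{Y})$, such that $\max_{y\in\mathcal{Y}}x^\top Ay-v^\ast\ge\alpha\cdot\mathrm{dist}(x,\mathcal{X}^\ast)$ for all $x\in\mathcal{X}$, and let $\mu\in\left(0,\frac{\alpha}{\max_{x\in\mathcal{X}}\|x\|}\right)$. There is a constant $c_\mu>0$, depending only on $A,\mathcal{X},\mathcal{Y},\mu$, with $\mathrm{dist}(z,\mathcal{Z}^\mu)\le c_\mu\min_{v\in\mathcal{N}_{\mathcal{Z}}(z)}\|F_\mu^x(z)+v\|$ for all $z\in\mathcal{Z}$, and such that, setting $$\beta_\mu:=\left(\frac{\mu}{\mu^2+\|A\|^2}+c_\mu\left(1+\frac{\mu(\mu+\|A\|)}{\mu^2+\|A\|^2}\right)\right)\left(1+\frac{\mu\|A\|}{\mu^2+\|A\|^2}\right)>0$$ (independent of $\eta$), the following holds. For every $\eta$ with $0<\eta\le\frac{\mu}{\mu^2+\|A\|^2}$ and every $z^1=(x^1,y^1)\in\mathcal{Z}$, the iterates of AsymP-GDA, $$x^{t+1}=\Pi_{\mathcal{X}}\left(x^t-\eta(Ay^t+\mu x^t)\right),\qquad y^{t+1}=\Pi_{\mathcal{Y}}\left(y^t+\eta A^\top x^{t+1}\right),$$ are such that $x^t$ converges at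 a linear rate to an equilibrium strategy of the original game: there is $x^\ast\in\mathcal{X}^\ast$ with, for all $t\ge1$, $$\|x^\ast-x^t\|^2\le\left(\frac{1}{1+\eta^2/(2\beta_\mu^2)}\right)^{t-1}\mathrm{dist}(z^1,\mathcal{Z}^\mu)^2.$$
   Context: A polytope is a bounded polyhedron (compact). $\|\cdot\|$ is the Euclidean norm for vectors; $\|A\|$ is the largest singular value of $A$. $\Pi_S$ is Euclidean projection onto a closed convex set $S$, and $\mathrm{dist}(a,S)=\|a-\Pi_S(a)\|$. The original game is $\min_{x\in\mathcal{X}}\max_{y\in\mathcal{Y}}x^\top Ay$ with value $v^\ast=\min_{x\in\mathcal{X}}\max_{y\in\mathcal{Y}}x^\top Ay$ and minimax set $\mathcal{X}^\ast=\operatorname{argmin}_{x\in\mathcal{X}}\max_{y\in\mathcal{Y}}x^\top Ay$. A constant $\alpha>0$ with the stated growth property is known to exist for every such game. The perturbed game is $\min_{x\in\mathcal{X}}\max_{y\in\mathcal{Y}}\{x^\top Ay+\frac{\mu}{2}\|x\|^2\}$; $x^\mu=\operatorname{argmin}_{x\in\mathcal{X}}\max_{y\in\mathcal{Y}}\{x^\top Ay+\frac{\mu}{2}\|x\|^2\}$ is its unique minimax strategy, $\mathcal{Y}^\mu=\operatorname{argmax}_{y\in\mathcal{Y}}\min_{x\in\mathcal{X}}\{x^\top Ay+\frac{\mu}{2}\|x\|^2\}$ its set of maximin strategies, and $\mathcal{Z}^\mu=\{x^\mu\}\times\mathcal{Y}^\mu$. $F_\mu^x(z)=(Ay+\mu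 x,\,-A^\top x)$ for $z=(x,y)$. The normal cone to a closed convex set $\mathcal{C}$ at $z\in\mathcal{C}$ is $\mathcal{N}_{\mathcal{C}}(z)=\{v:\langle v,z'-z\rangle\le0\ \forall z'\in\mathcal{C}\}$. *)

(* Defs.v *)
From HB Require Import structures.
From mathcomp Require Import all_boot all_order all_algebra.
From mathcomp Require Import all_classical all_reals all_analysis.
Set Implicit Arguments.
Unset Strict Implicit.
Unset Printing Implicit Defensive.
Import Order.TTheory GRing.Theory Num.Theory.
Import numFieldNormedType.Exports.
Local Open Scope classical_set_scope.
Local Open Scope ring_scope.

(* Vectors of R^k are columns 'cV[R]_k.  The library norm `|x| on matrices is
   the sup norm, so the Euclidean norm is defined here. *)
Definition dot (R : realType) (k : nat) (u v : 'cV[R]_k) : R :=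
  \sum_(i < k) u i 0 * v i 0.

Definition enorm (R : realType) (k : nat) (u : 'cV[R]_k) : R :=
  Num.sqrt (dot u u).

Definition singular_values (R : realType) (m n : nat) (A : 'M[R]_(m, n)) :
    set R :=
  [set s | 0 <= s /\ eigenvalue (A^T *m A) (s ^+ 2)].

(* The set of singular values is finite; it is empty, giving 0, only if
   n = 0. *)
Definition spectral_norm (R : realType) (m n : nat) (A : 'M[R]_(m, n)) : R :=
  sup (singular_values A).

Definition polyhedron (R : realType) (k : nat) (S : set 'cV[R]_k) : Prop :=
  exists (p : nat) (B : 'M[R]_(p, k)) (b : 'cV[R]_p),
    S = [set x | forall i, (B *m x) i 0 <= b i 0].

Definition polytope (R : realType) (k : nat) (S : set 'cV[R]_k) : Prop :=
  polyhedron S /\ bounded_set S.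

(* Maxima and minima over a set are rendered by sup and inf; those occurring
   below are attained when the underlying sets are nonempty and compact. *)
Definition max_over (R : realType) (T : Type) (S : set T) (g : T -> R) : R :=
  sup [set g x | x in S].

Definition min_over (R : realType) (T : Type) (S : set T) (g : T -> R) : R :=
  inf [set g x | x in S].

Definition argmin (R : realType) (T : Type) (S : set T) (g : T -> R) : set T :=
  [set x | S x /\ forall x', S x' -> g x <= g x'].

Definition argmax (R : realType) (T : Type) (S : set T) (g : T -> R) : set T :=
  [set x | S x /\ forall x', S x' -> g x' <= g x].

(* The point of S nearest to a: it exists and is unique if S is nonempty,
   closed and convex. *)
Definition proj (R : realType) (k : nat) (S : set 'cV[R]_k) (a : 'cV[R]_k) :
    'cV[R]_k :=
  xget 0 (argmin S (fun p => enorm (a - p))).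

Definition dist (R : realType) (k : nat) (a : 'cV[R]_k) (S : set 'cV[R]_k) : R :=
  enorm (a - proj S a).

Definition normal_cone (R : realType) (k : nat) (C : set 'cV[R]_k)
    (z : 'cV[R]_k) : set 'cV[R]_k :=
  [set v | forall z', C z' -> dot v (z' - z) <= 0].

(* A pair (x, y) of R^m x R^n is the column col_mx x y of R^(m + n), so that
   norms, distances and normal cones of pairs are those of R^(m + n). *)
Definition prod_set (R : realType) (m n : nat) (X : set 'cV[R]_m)
    (Y : set 'cV[R]_n) : set 'cV[R]_(m + n) :=
  [set col_mx x y | x in X & y in Y].

Definition minimax_value (R : realType) (U V : Type) (X : set U) (Y : set V)
    (f : U -> V -> R) : R :=
  min_over X (fun x => max_over Y (fun y => f x y)).

Definition minimax_set (R : realType) (U V : Type) (X : set U) (Y : set V)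
    (f : U -> V -> R) : set U :=
  argmin X (fun x => max_over Y (fun y => f x y)).

Definition maximin_set (R : realType) (U V : Type) (X : set U) (Y : set V)
    (f : U -> V -> R) : set V :=
  argmax Y (fun y => min_over X (fun x => f x y)).

Definition payoff (R : realType) (m n : nat) (A : 'M[R]_(m, n))
    (x : 'cV[R]_m) (y : 'cV[R]_n) : R :=
  (x^T *m A *m y) 0 0.

Definition perturbed_payoff (R : realType) (m n : nat) (A : 'M[R]_(m, n))
    (mu : R) (x : 'cV[R]_m) (y : 'cV[R]_n) : R :=
  payoff A x y + mu / 2 * enorm x ^+ 2.

(* The argmin is a singleton for mu > 0 and nonempty polytopes X, Y. *)
Definition x_mu (R : realType) (m n : nat) (A : 'M[R]_(m, n))
    (X : set 'cV[R]_m) (Y : set 'cV[R]_n) (mu : R) : 'cV[R]_m :=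
  xget 0 (minimax_set X Y (perturbed_payoff A mu)).

Definition Y_mu (R : realType) (m n : nat) (A : 'M[R]_(m, n))
    (X : set 'cV[R]_m) (Y : set 'cV[R]_n) (mu : R) : set 'cV[R]_n :=
  maximin_set X Y (perturbed_payoff A mu).

Definition Z_mu (R : realType) (m n : nat) (A : 'M[R]_(m, n))
    (X : set 'cV[R]_m) (Y : set 'cV[R]_n) (mu : R) : set 'cV[R]_(m + n) :=
  prod_set [set x_mu A X Y mu] (Y_mu A X Y mu).

Definition F_mu (R : realType) (m n : nat) (A : 'M[R]_(m, n)) (mu : R)
    (z : 'cV[R]_(m + n)) : 'cV[R]_(m + n) :=
  col_mx (A *m dsubmx z + mu *: usubmx z) (- (A^T *m usubmx z)).

Definition beta_mu (R : realType) (m n : nat) (A : 'M[R]_(m, n)) (mu c : R) : R :=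
  let a := spectral_norm A in
  (mu / (mu ^+ 2 + a ^+ 2)
   + c * (1 + mu * (mu + a) / (mu ^+ 2 + a ^+ 2)))
  * (1 + mu * a / (mu ^+ 2 + a ^+ 2)).

(* Iterates are indexed from t = 1; the values at t = 0 are irrelevant. *)
Definition asymp_gda (R : realType) (m n : nat) (A : 'M[R]_(m, n))
    (X : set 'cV[R]_m) (Y : set 'cV[R]_n) (mu eta : R)
    (x : nat -> 'cV[R]_m) (y : nat -> 'cV[R]_n) : Prop :=
  forall t : nat, (1 <= t)%N ->
    x t.+1 = proj X (x t - eta *: (A *m y t + mu *: x t)) /\
    y t.+1 = proj Y (y t + eta *: (A^T *m x t.+1)).

(* Main.v *)
Require Import Defs.
From HB Require Import structures.
From mathcomp Require Import all_boot all_order all_algebra.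
From mathcomp Require Import all_classical all_reals all_analysis.
From mathcomp Require Import ring lra.
Set Implicit Arguments.
Unset Strict Implicit.
Unset Printing Implicit Defensive.
Import Order.TTheory GRing.Theory Num.Theory.
Import numFieldNormedType.Exports.
Local Open Scope classical_set_scope.
Local Open Scope ring_scope.

(** The perturbed game is strongly convex in x.  Its dual function has a
    maximizer y on Y, and an envelope argument shows that y together with its
    best response x is a saddle point; hence x is x_mu, and Z_mu is the set of
    all saddle points, i.e., of solutions of the variational inequality
    0 in F_mu (z) + N_Z (z)  (argmax_dual_value_saddle, saddle_x_mu, Y_muP).

    The constant c_mu comes from polyhedrality.  A polytope is the convex hull
    of its vertices, used as an induction principle (polytope_ind).  Applied
    to a lifted polytope of pairs (point, violation), it yields Hoffman's
    bound for linear inequalities over a polytope (hoffman_bound).  Since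
    stationarity of x_mu amounts to finitely many inequalities in y, one per
    vertex of X, this bounds the distance from y to Y_mu linearly in the
    residual and in |x - x_mu|; strong monotonicity in x then absorbs
    |x - x_mu| (perturbed_error_bound).

    For the iteration, the projection inequalities of both steps and the
    saddle inequalities give |z' - z*|^2 <= |z - z*|^2 - |z' - z|^2 / 2 for
    every z* in Z_mu (gda_step_descent), while the residual at z' is
    O(|z' - z| / eta) (gda_step_residual).  With the error bound, the distance
    to Z_mu contracts geometrically (gda_step_contraction), and it dominates
    |x_mu - x^t|.

    Finally x_mu itself is a minimax strategy of the original game: by the
    linear growth of the payoff away from the minimax set, a perturbation with
    mu max |x| < alpha is too weak to pull the minimizer off that set
    (x_mu_minimax).  So x_mu is the limit strategy. *)

(** * Euclidean geometry of columns *)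

Lemma dotC (R : realType) k (u v : 'cV[R]_k) : dot u v = dot v u.
Proof. by apply: eq_bigr => i _; rewrite mulrC. Qed.

Lemma dotDr (R : realType) k (u v w : 'cV[R]_k) :
  dot u (v + w) = dot u v + dot u w.
Proof. by rewrite -big_split; apply: eq_bigr => i _; rewrite mxE mulrDr. Qed.

Lemma dotZr (R : realType) k (a : R) (u v : 'cV[R]_k) :
  dot u (a *: v) = a * dot u v.
Proof. by rewrite mulr_sumr; apply: eq_bigr => i _; rewrite mxE mulrCA. Qed.

Lemma dotNr (R : realType) k (u v : 'cV[R]_k) : dot u (- v) = - dot u v.
Proof. by rewrite -scaleN1r dotZr mulN1r. Qed.

Lemma dotDl (R : realType) k (u v w : 'cV[R]_k) :
  dot (v + w) u = dot v u + dot w u.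
Proof. by rewrite dotC dotDr !(dotC u). Qed.

Lemma dotZl (R : realType) k (a : R) (u v : 'cV[R]_k) :
  dot (a *: v) u = a * dot v u.
Proof. by rewrite dotC dotZr dotC. Qed.

Lemma dotNl (R : realType) k (u v : 'cV[R]_k) : dot (- v) u = - dot v u.
Proof. by rewrite dotC dotNr dotC. Qed.

Lemma dot0r (R : realType) k (u : 'cV[R]_k) : dot u 0 = 0.
Proof. by rewrite -(scale0r u) dotZr mul0r. Qed.

Definition dotE := (dotDl, dotDr, dotZl, dotZr, dotNl, dotNr).

Lemma dot_col_mx (R : realType) m n (x x' : 'cV[R]_m) (y y' : 'cV[R]_n) :
  dot (col_mx x y) (col_mx x' y') = dot x x' + dot y y'.
Proof.
rewrite /dot big_split_ord /=.
by congr (_ + _); apply: eq_bigr => i _; rewrite ?col_mxEu ?col_mxEd.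
Qed.

Lemma dot_trmx (R : realType) m n (A : 'M[R]_(m, n)) x y :
  dot (A^T *m x) y = dot x (A *m y).
Proof.
have E k (u v : 'cV[R]_k) : dot u v = (u^T *m v) 0 0.
  by rewrite mxE; apply: eq_bigr => i _; rewrite mxE.
by rewrite !E trmx_mul trmxK mulmxA.
Qed.

Lemma payoffE (R : realType) m n (A : 'M[R]_(m, n)) x y :
  payoff A x y = dot x (A *m y).
Proof.
rewrite /payoff -mulmxA mxE; apply: eq_bigr => i _.
by rewrite mxE.
Qed.

Lemma dot_ge0 (R : realType) k (u : 'cV[R]_k) : 0 <= dot u u.
Proof. by apply: sumr_ge0 => i _; rewrite -expr2 sqr_ge0. Qed.

Lemma enorm_ge0 (R : realType) k (u : 'cV[R]_k) : 0 <= enorm u.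
Proof. exact: sqrtr_ge0. Qed.

Lemma enorm_sqr (R : realType) k (u : 'cV[R]_k) : enorm u ^+ 2 = dot u u.
Proof. by rewrite sqr_sqrtr ?dot_ge0. Qed.

Lemma enorm_le (R : realType) k (u : 'cV[R]_k) (c : R) :
  0 <= c -> dot u u <= c ^+ 2 -> enorm u <= c.
Proof. by move=> c0; rewrite -enorm_sqr ler_pXn2r ?nnegrE ?enorm_ge0. Qed.

Lemma dot_eq0 (R : realType) k (u : 'cV[R]_k) : dot u u = 0 -> u = 0.
Proof.
move/psumr_eq0P => H; apply/matrixP => i j; rewrite (ord1 j) [RHS]mxE.
apply/eqP; rewrite -sqrf_eq0 expr2; apply/eqP/H => // l _.
by rewrite -expr2 sqr_ge0.
Qed.

Lemma enorm_eq0 (R : realType) k (u : 'cV[R]_k) : enorm u = 0 -> u = 0.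
Proof. by move=> u0; apply: dot_eq0; rewrite -enorm_sqr u0 expr0n. Qed.

Lemma enorm0 (R : realType) k : enorm (0 : 'cV[R]_k) = 0.
Proof. by rewrite /enorm dot0r sqrtr0. Qed.

(** Cauchy--Schwarz, from the squared norm of |v|^2 u - (u.v) v. *)
Lemma dot_le (R : realType) k (u v : 'cV[R]_k) :
  dot u v <= enorm u * enorm v.
Proof.
have [v0|v0] := eqVneq v 0.
  by rewrite v0 enorm0 mulr0 dot0r.
have vp : 0 < dot v v.
  by rewrite lt_neqAle dot_ge0 andbT; apply: contraNneq v0 => /esym/dot_eq0 ->.
have := dot_ge0 (dot v v *: u - dot u v *: v).
rewrite !dotE (dotC v u) => H.
have {}H : 0 <= dot v v * (dot u u * dot v v - dot u v ^+ 2) by lra.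
have {}H : dot u v ^+ 2 <= (enorm u * enorm v) ^+ 2.
  by rewrite exprMn !enorm_sqr -subr_ge0 -(pmulr_rge0 _ vp).
have p : 0 <= enorm u * enorm v by rewrite mulr_ge0 ?enorm_ge0.
have [n|n] := lerP (dot u v) 0; first exact: le_trans p.
by rewrite ler_pXn2r ?nnegrE // ltW in H.
Qed.

Lemma enormN (R : realType) k (u : 'cV[R]_k) : enorm (- u) = enorm u.
Proof. by rewrite /enorm dotNl dotNr opprK. Qed.

Lemma enormB (R : realType) k (u v : 'cV[R]_k) : enorm (u - v) = enorm (v - u).
Proof. by rewrite -enormN opprB. Qed.

Lemma enormZ (R : realType) k (a : R) (u : 'cV[R]_k) :
  enorm (a *: u) = `|a| * enorm u.
Proof.
by rewrite /enorm dotZl dotZr mulrA -expr2 sqrtrM ?sqr_ge0 // sqrtr_sqr.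
Qed.

Lemma ler_enormD (R : realType) k (u v : 'cV[R]_k) :
  enorm (u + v) <= enorm u + enorm v.
Proof.
apply: enorm_le; first by rewrite addr_ge0 ?enorm_ge0.
rewrite sqrrD !enorm_sqr !dotE (dotC v u).
have := dot_le u v; lra.
Qed.

Lemma ler_enormB (R : realType) k (u v w : 'cV[R]_k) :
  enorm (u - w) <= enorm (u - v) + enorm (v - w).
Proof. by have := ler_enormD (u - v) (v - w); rewrite subrKA. Qed.

Lemma enorm_col_mx_le (R : realType) m n (x : 'cV[R]_m) (y : 'cV[R]_n) :
  enorm (col_mx x y) <= enorm x + enorm y.
Proof.
apply: enorm_le; first by rewrite addr_ge0 ?enorm_ge0.
rewrite dot_col_mx sqrrD !enorm_sqr.
have := mulr_ge0 (enorm_ge0 x) (enorm_ge0 y); lra.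
Qed.

Lemma enorm_usub_le (R : realType) m n (x : 'cV[R]_m) (y : 'cV[R]_n) :
  enorm x <= enorm (col_mx x y).
Proof.
by apply: enorm_le; rewrite ?enorm_ge0 // enorm_sqr dot_col_mx lerDl dot_ge0.
Qed.

Lemma enorm_dsub_le (R : realType) m n (x : 'cV[R]_m) (y : 'cV[R]_n) :
  enorm y <= enorm (col_mx x y).
Proof.
by apply: enorm_le; rewrite ?enorm_ge0 // enorm_sqr dot_col_mx lerDr dot_ge0.
Qed.

Lemma entry_le_enorm (R : realType) k (u : 'cV[R]_k) i : `|u i 0| <= enorm u.
Proof.
rewrite -sqrtr_sqr ler_wsqrtr // expr2 /dot (bigD1 i) //= lerDl.
by apply: sumr_ge0 => j _; rewrite -expr2 sqr_ge0.
Qed.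

(** The Frobenius norm bounds the operator norm, by Cauchy--Schwarz on each
    row. *)
Lemma mulmx_bounded (R : realType) m n (A : 'M[R]_(m, n)) :
  exists2 C, 0 <= C & forall v, enorm (A *m v) <= C * enorm v.
Proof.
pose r i := (row i A)^T.
have s0 : 0 <= \sum_i dot (r i) (r i) by apply: sumr_ge0 => i _; exact: dot_ge0.
exists (Num.sqrt (\sum_i dot (r i) (r i))) => [|v]; first exact: sqrtr_ge0.
apply: enorm_le; first by rewrite mulr_ge0 ?sqrtr_ge0 ?enorm_ge0.
rewrite exprMn sqr_sqrtr // mulr_suml; apply: ler_sum => i _.
have -> : (A *m v) i 0 = dot (r i) v.
  by rewrite mxE; apply: eq_bigr => j _; rewrite !mxE.
have H w : dot w v ^+ 2 <= dot w w * enorm v ^+ 2.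
  have := dot_le w v; have := dot_le (- w) v.
  rewrite enormN dotNl -enorm_sqr -exprMn => a b.
  have p : 0 <= enorm w * enorm v by rewrite mulr_ge0 ?enorm_ge0.
  by rewrite -(ler_sqrt _ (sqr_ge0 _)) !sqrtr_sqr (ger0_norm p) ler_norml b lerNl a.
by rewrite -expr2.
Qed.

Lemma enorm_le_entries (R : realType) k (u : 'cV[R]_k) (M : R) :
  0 <= M -> (forall i, `|u i 0| <= M) -> enorm u <= Num.sqrt k%:R * M.
Proof.
move=> M0 uM; apply: enorm_le; first by rewrite mulr_ge0 ?sqrtr_ge0.
rewrite exprMn sqr_sqrtr ?ler0n // mulr_natl -[leRHS]/(M ^+ 2 *+ k).
rewrite -[k in leRHS]card_ord -sumr_const; apply: ler_sum => i _.
by rewrite -expr2 -real_normK ?num_real // ler_pXn2r ?nnegrE.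
Qed.

Lemma entry_le_norm (R : realType) m n (x : 'M[R]_(m, n)) i j :
  `|x i j| <= `|x|.
Proof.
rewrite /Num.norm /= mx_normrE.
exact: (le_bigmax _ (fun ij : 'I_m * 'I_n => `|x ij.1 ij.2|) (i, j)).
Qed.

Lemma enorm_bounded (R : realType) k (S : set 'cV[R]_k) :
  bounded_set S -> exists2 M, 0 <= M & forall x, S x -> enorm x <= M.
Proof.
case=> M0 [_ /(_ (`|M0| + 1))] => /(_ (ltr_pwDr ltr01 (ler_norm _))).
have : 0 <= `|M0| + 1 by rewrite addr_ge0.
move: (`|M0| + 1) => M M_ge0 HM.
exists (Num.sqrt k%:R * M) => [|x Sx]; first by rewrite mulr_ge0 ?sqrtr_ge0.
apply: enorm_le_entries => // i.
exact: le_trans (entry_le_norm _ _ _) (HM x Sx).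
Qed.

Lemma lipschitz_continuous (R : realType) k (g : 'cV[R]_k -> R) (L : R) :
    0 <= L -> (forall x x', g x - g x' <= L * enorm (x - x')) ->
  continuous g.
Proof.
move=> L0 gL x P /nbhs_ballP [e e0 He]; apply/nbhs_ballP.
have d0 : 0 < L * Num.sqrt k%:R + 1.
  by rewrite ltr_wpDl // mulr_ge0 ?sqrtr_ge0.
exists (e / (L * Num.sqrt k%:R + 1)) => /=; first exact: divr_gt0.
move=> x' [e1 Hx]; apply: He; rewrite /ball /=.
have H : L * enorm (x - x') < e.
  apply: (@le_lt_trans _ _
    (L * (Num.sqrt k%:R * (e / (L * Num.sqrt k%:R + 1))))).
    apply: ler_wpM2l => //; apply: enorm_le_entries => [|i]; first exact: ltW.
    by rewrite !mxE; have := Hx i 0; rewrite /ball /= => /ltW.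
  by rewrite mulrA mulrA ltr_pdivrMr // mulrC mulrDr mulr1 ltrDl.
have := gL x x'; have := gL x' x; rewrite (enormB x') => a b.
rewrite ltr_norml ltrNl opprB (le_lt_trans a) //=; exact: le_lt_trans b H.
Qed.

Lemma lipschitz_closed_le (R : realType) k (g : 'cV[R]_k -> R) (L b : R) :
    0 <= L -> (forall x x', g x - g x' <= L * enorm (x - x')) ->
  closed [set x | g x <= b].
Proof.
move=> L0 /(lipschitz_continuous L0)/continuous_closedP H.
exact: H _ (closed_le (y := b)).
Qed.

(** Heine--Borel holds for rows, and transposition carries it to columns. *)
Lemma lipschitz_argmin (R : realType) k (S : set 'cV[R]_k)
    (g : 'cV[R]_k -> R) (L : R) :
    closed S -> bounded_set S -> S !=set0 -> 0 <= L ->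
    (forall x x', g x - g x' <= L * enorm (x - x')) ->
  argmin S g !=set0.
Proof.
move=> cS bS [x0 Sx0] L0 gL.
have trc : continuous (fun r : 'rV[R]_k => r^T).
  move=> r P /nbhs_ballP [e e0 He]; apply/nbhs_ballP; exists e => // r' [e1 Hr].
  by apply: He; split => // i j; rewrite !mxE.
have cS' : compact [set r : 'rV[R]_k | S r^T].
  apply: bounded_closed_compact; last exact: (continuous_closedP _).1 trc _ cS.
  case: (bS) => M [Mr HM]; exists M; split => // M' MM' r Sr.
  apply: le_trans (HM _ MM' _ Sr).
  rewrite [leLHS]mx_normrE; apply: bigmax_le => [|[i j] _ /=].
    exact: normr_ge0.
  by have := entry_le_norm (r^T : 'cV_k) j i; rewrite mxE.
have gc : continuous (fun r : 'rV[R]_k => g r^T).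
  by move=> r; apply: continuous_comp (trc r) _; exact: lipschitz_continuous gL _.
have [|r /set_mem Sr rmin] := compact_EVT_min _ cS' (continuous_subspaceT gc).
  by exists x0^T; rewrite /= trmxK.
exists r^T; split => // x Sx.
by rewrite -(trmxK x); apply: rmin; rewrite inE /= trmxK.
Qed.

(** * Projections onto convex sets and the spectral norm *)

Definition segment_closed (R : realType) (V : lmodType R) (S : set V) : Prop :=
  forall (t : R) u v, 0 <= t <= 1 -> S u -> S v -> S (t *: u + (1 - t) *: v).

Lemma polyhedron_closed (R : realType) k (S : set 'cV[R]_k) :
  polyhedron S -> closed S.
Proof.
case=> p [B [b ->]]; have [C C0 BC] := mulmx_bounded B.
have -> : [set x | forall i, (B *m x) i 0 <= b i 0] =
    \bigcap_(i in setT) [set x : 'cV[R]_k | (B *m x) i 0 <= b i 0].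
  by apply/seteqP; split => x /= H i; [move=> _; exact: H|exact: H].
apply: closed_bigI => i _; apply: lipschitz_closed_le C0 _ => x x'.
apply: le_trans (BC _); rewrite mulmxBr.
have -> (u v : 'cV[R]_p) : u i 0 - v i 0 = (u - v) i 0 by rewrite !mxE.
exact: le_trans (ler_norm _) (entry_le_enorm _ _).
Qed.

Lemma polyhedron_segment_closed (R : realType) k (S : set 'cV[R]_k) :
  polyhedron S -> segment_closed S.
Proof.
case=> p [B [b ->]] t u v /andP[t0 t1] Su Sv i.
rewrite mulmxDr -!scalemxAr.
have -> (x y : 'cV[R]_p) : (t *: x + (1 - t) *: y) i 0 = t * x i 0 + (1 - t) * y i 0.
  by rewrite !mxE.
have := ler_wpM2l t0 (Su i); rewrite -subr_ge0 in t1.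
have := ler_wpM2l t1 (Sv i); lra.
Qed.

Lemma le0_of_small_le (R : realType) (a b : R) :
  (forall t, 0 < t -> t <= 1 -> a <= t * b) -> a <= 0.
Proof.
move=> H; rewrite leNgt; apply/negP => a0.
have d : 0 < a + `|b| by rewrite ltr_pwDl.
have t0 : 0 < a / (a + `|b|) by exact: divr_gt0.
have := H _ t0; rewrite ler_pdivrMr // mul1r lerDl normr_ge0 => /(_ isT).
have bb := ler_norm b.
rewrite mulrAC ler_pdivlMr // ler_pM2l //; lra.
Qed.

Lemma argmin_proj (R : realType) k (S : set 'cV[R]_k) (a : 'cV[R]_k) :
    closed S -> bounded_set S -> S !=set0 ->
  argmin S (fun p => enorm (a - p)) (Defs.proj S a).
Proof.
move=> cS bS S0; apply: xgetPex; apply: (lipschitz_argmin (L := 1)) => // x x'.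
by rewrite mul1r lerBlDl (enormB x); exact: ler_enormB.
Qed.

(** Moving from the nearest point p a fraction t of the way to x cannot come
    closer to a, so 2 (a - p).(x - p) <= t |x - p|^2; let t tend to 0. *)
Lemma proj_obtuse (R : realType) k (S : set 'cV[R]_k) (a x : 'cV[R]_k) :
    closed S -> bounded_set S -> segment_closed S -> S x ->
  dot (a - Defs.proj S a) (x - Defs.proj S a) <= 0.
Proof.
move=> cS bS sS Sx.
have [|Sp pmin] := argmin_proj a cS bS; first by exists x.
move: (Defs.proj S a) Sp pmin => p Sp pmin.
apply: (@le0_of_small_le _ _ (dot (x - p) (x - p) / 2)) => t t0 t1.
have t01 : 0 <= t <= 1 by rewrite ltW.
have := pmin _ (sS t x p t01 Sx Sp).
have -> : a - (t *: x + (1 - t) *: p) = (a - p) - t *: (x - p).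
  by apply/matrixP => i j; rewrite !mxE; ring.
rewrite -ler_sqr ?nnegrE ?enorm_ge0 // !enorm_sqr.
move: (a - p) (x - p) => u v; rewrite !dotE (dotC v u) => H.
rewrite -(ler_pM2l t0); lra.
Qed.

Lemma dist_le (R : realType) k (S : set 'cV[R]_k) (a x : 'cV[R]_k) :
  argmin S (fun p => enorm (a - p)) !=set0 -> S x -> dist a S <= enorm (a - x).
Proof. by case=> p /(xgetI 0) [_ +] Sx => /(_ _ Sx). Qed.

Lemma dist_eq0 (R : realType) k (S : set 'cV[R]_k) (a : 'cV[R]_k) :
  argmin S (fun p => enorm (a - p)) !=set0 -> dist a S = 0 -> S a.
Proof.
case=> p /(xgetI 0) [Sp _] /enorm_eq0/eqP.
by rewrite subr_eq0 => /eqP aS; rewrite aS.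
Qed.

Lemma max_over_argmax (R : realType) T (S : set T) (g : T -> R) x :
  argmax S g x -> max_over S g = g x.
Proof.
move=> [Sx gx]; have ub : ubound [set g x | x in S] (g x) by move=> _ [y /gx ? <-].
apply/le_anti/andP; split; first by apply: ge_sup => //; exists (g x), x.
by apply: ub_le_sup; [exists (g x)|exists x].
Qed.

Lemma min_over_argmin (R : realType) T (S : set T) (g : T -> R) x :
  argmin S g x -> min_over S g = g x.
Proof.
move=> [Sx gx]; have lb : lbound [set g x | x in S] (g x) by move=> _ [y /gx ? <-].
apply/le_anti/andP; split; last by apply: lb_le_inf => //; exists (g x), x.
by apply: ge_inf; [exists (g x)|exists x].
Qed.

(** A unit vector v maximizing |Av| is an eigenvector of A^T A: the form
    |Av|^2 |x|^2 - |Ax|^2 is nonnegative and vanishes at v, so its gradient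
    vanishes there.  Hence |Av| is a singular value, and the largest one. *)
Lemma spectral_norm_attained (R : realType) m n (A : 'M[R]_(m, n)) :
  (0 < n)%N -> exists2 s, singular_values A s &
    forall x, enorm (A *m x) <= s * enorm x.
Proof.
case: n A => // n A _; have [C C0 AC] := mulmx_bounded A.
pose S : set 'cV[R]_n.+1 := [set u | enorm u <= 1] `&` [set u | - enorm u <= - 1].
have enormL k (x x' : 'cV[R]_k) : enorm x - enorm x' <= 1 * enorm (x - x').
  by rewrite mul1r lerBlDr; apply: le_trans (ler_enormD _ _); rewrite subrK.
have cS : closed S.
  apply: closedI; first by apply: lipschitz_closed_le ler01 _; exact: enormL.
  apply: lipschitz_closed_le ler01 _ => x x'.
  by rewrite opprK addrC (enormB x); exact: enormL.
have bS : bounded_set S.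
  exists 1; split => // M M1 u [u1 _]; apply: le_trans (ltW M1).
  rewrite [leLHS]mx_normrE; apply: bigmax_le => // -[i j] _ /=; rewrite (ord1 j).
  exact: le_trans (entry_le_enorm _ _) u1.
have S0 : S !=set0.
  exists (delta_mx 0 0); rewrite /S /=.
  have -> : enorm (delta_mx 0 0 : 'cV[R]_n.+1) = 1.
    rewrite /enorm /dot (bigD1 0) //= big1 => [|i i0]; rewrite !mxE.
      by rewrite eqxx mulr1 addr0 sqrtr1.
    by rewrite (negbTE i0) mul0r.
  by split.
have [v [[/= v1 v1'] vmax]] : argmin S (fun u => - enorm (A *m u)) !=set0.
  apply: lipschitz_argmin cS bS S0 C0 _ => x x'.
  rewrite opprK addrC; apply: le_trans (enormL _ _ _) _.
  by rewrite mul1r -mulmxBr (enormB x).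
have {v1'}v1 : enorm v = 1 by apply/le_anti; rewrite v1 -lerN2 v1'.
have {}vmax x : enorm (A *m x) <= enorm (A *m v) * enorm x.
  have [->|x0] := eqVneq x 0; first by rewrite mulmx0 !enorm0 mulr0.
  have xp : 0 < enorm x.
    by rewrite lt_neqAle enorm_ge0 andbT; apply: contraNneq x0 => /esym/enorm_eq0 ->.
  have nZ k (w : 'cV[R]_k) : enorm ((enorm x)^-1 *: w) = (enorm x)^-1 * enorm w.
    by rewrite enormZ ger0_norm // invr_ge0 enorm_ge0.
  have Sx : S ((enorm x)^-1 *: x) by rewrite /S /= nZ mulVf ?gt_eqF.
  by have := vmax _ Sx; rewrite lerN2 -scalemxAr nZ ler_pdivrMl // mulrC.
exists (enorm (A *m v)) => //; split; first exact: enorm_ge0.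
set lam := enorm (A *m v) ^+ 2.
have grad w : lam * dot v w - dot (A *m v) (A *m w) <= 0.
  apply: (@le0_of_small_le _ _ ((lam * dot w w - dot (A *m w) (A *m w)) / 2)).
  move=> t t0 _.
  have : enorm (A *m (v - t *: w)) ^+ 2 <= lam * enorm (v - t *: w) ^+ 2.
    rewrite /lam -exprMn ler_pXn2r ?nnegrE ?mulr_ge0 ?enorm_ge0 //.
  rewrite mulmxBr -scalemxAr !enorm_sqr !dotE -!enorm_sqr v1 expr1n -/lam !enorm_sqr.
  rewrite (dotC w v) (dotC (A *m w)) => H.
  rewrite -(ler_pM2l t0); lra.
apply/eigenvalueP; exists v^T; last first.
  apply/eqP => v0; have := v1; rewrite -(trmxK v) v0 trmx0 enorm0 => /eqP.
  by rewrite eq_sym oner_eq0.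
apply: trmx_inj; rewrite linearZ /= trmx_mul trmx_mul !trmxK.
apply/eqP; rewrite -subr_eq0; apply/eqP/dot_eq0/le_anti; rewrite dot_ge0 andbT.
have := grad (lam *: v - A^T *m (A *m v)).
rewrite -dot_trmx -!mulmxA; move: (A^T *m (A *m v)) => w.
by rewrite !dotE (dotC w v); lra.
Qed.

Lemma spectral_norm_spec (R : realType) m n (A : 'M[R]_(m, n)) :
  0 <= spectral_norm A /\
  forall x, enorm (A *m x) <= spectral_norm A * enorm x.
Proof.
have [n0|n0] := posnP n.
  have x0 (x : 'cV[R]_n) : x = 0 by apply/matrixP => i; have := ltn_ord i; rewrite {2}n0.
  split; last by move=> x; rewrite (x0 x) mulmx0 !enorm0 mulr0.
  rewrite /spectral_norm (_ : singular_values A = set0) ?sup0 //.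
  rewrite -subset0 => s [_ /eigenvalueP[v _ /eqP]]; apply.
  by apply: trmx_inj; rewrite (x0 v^T) trmx0.
have [s s_sv As] := spectral_norm_attained A n0.
suff -> : spectral_norm A = s by case: s_sv.
have ub : ubound (singular_values A) s.
  move=> r [r0 /eigenvalueP[v vA v0]].
  have xp : 0 < enorm v^T.
    rewrite lt_neqAle enorm_ge0 andbT; apply: contraNneq v0 => /esym/enorm_eq0 vT.
    by rewrite -(trmxK v) vT trmx0.
  rewrite -(ler_pM2r xp); apply: le_trans (As _).
  rewrite -[leLHS]ger0_norm ?mulr_ge0 ?enorm_ge0 // -sqrtr_sqr ler_wsqrtr //.
  rewrite exprMn enorm_sqr -dotZl -dot_trmx -linearZ -vA /=.
  by rewrite trmx_mul trmx_mul trmxK mulmxA.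
apply/le_anti/andP; split; first by apply: ge_sup => //; exists s.
by apply: ub_le_sup => //; exists s.
Qed.

Lemma spectral_norm_ge0 (R : realType) m n (A : 'M[R]_(m, n)) :
  0 <= spectral_norm A.
Proof. by case: (spectral_norm_spec A). Qed.

Lemma ler_spectral_norm (R : realType) m n (A : 'M[R]_(m, n)) x :
  enorm (A *m x) <= spectral_norm A * enorm x.
Proof. by case: (spectral_norm_spec A). Qed.

Lemma dot_mulmx_le (R : realType) m n (A : 'M[R]_(m, n)) u v :
  dot u (A *m v) <= spectral_norm A * enorm u * enorm v.
Proof.
apply: le_trans (dot_le _ _) _; rewrite mulrAC [leRHS]mulrC.
by apply: ler_wpM2l; [exact: enorm_ge0|exact: ler_spectral_norm].
Qed.

(** * Vertices of polytopes *)

(** The step length is the least ratio of slack to slope among the constraints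
    that increase along d: the minimizing constraint becomes active, and the
    constraints active at x are constant along d. *)
Lemma polytope_step (R : realType) (V : lmodType R) (I : finType)
    (a : I -> V -> R) (b : I -> R) (x d : V) :
    (forall i t u v, a i (t *: u + v) = t * a i u + a i v) ->
    (forall i, a i x <= b i) ->
    (forall i, a i x = b i -> a i d = 0) -> (exists i, 0 < a i d) ->
  exists t, [/\ 0 < t, forall i, a i (t *: d + x) <= b i &
    ([set i | a i x == b i] \proper [set i | a i (t *: d + x) == b i])%SET].
Proof.
move=> lin xS dact [i0 di0]; pose r i := (b i - a i x) / a i d.
case: (@arg_minP _ _ _ i0 (fun i => 0 < a i d) r di0) => i di imin.
have ti : 0 < r i.
  rewrite divr_gt0 // subr_gt0 lt_neqAle xS andbT.
  by apply/eqP => /dact d0; rewrite d0 ltxx in di.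
exists (r i); split => // [j|].
  rewrite lin; have [dj|dj] := ltP 0 (a j d).
    have := imin j dj; rewrite /r ler_pdivlMr // => H; lra.
  have : r i * a j d <= 0 by rewrite pmulr_rle0.
  by have := xS j; lra.
apply/properP; split.
  by apply/fintype.subsetP => j; rewrite !inE => /eqP jx; rewrite lin dact // mulr0 add0r jx.
exists i; rewrite !inE ?lin.
  by rewrite /r (mulfVK (lt0r_neq0 di)) subrK.
by apply/eqP => /dact d0; rewrite d0 ltxx in di.
Qed.

(** Minkowski's theorem in the form of an induction principle.  A point that is
    not a vertex lies between two points with more active constraints, and a
    vertex is determined by its set of active constraints, so that there are
    finitely many vertices.  A trivial recession cone stands for boundedness:
    it is the form that passes to the lifted polytope of the error bound
    below. *)
Lemma polytope_ind (R : realType) (V : lmodType R) (I : finType)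
    (a : I -> V -> R) (b : I -> R) :
    (forall i t u v, a i (t *: u + v) = t * a i u + a i v) ->
    (forall d, (forall i, a i d <= 0) -> d = 0) ->
  exists vs : seq V, (forall v, v \in vs -> forall i, a i v <= b i) /\
    forall Q : set V, segment_closed Q -> (forall v, v \in vs -> Q v) ->
      forall x, (forall i, a i x <= b i) -> Q x.
Proof.
move=> lin rec.
have a0 i : a i 0 = 0.
  by have := lin i 1 0 0; rewrite scaler0 addr0 mul1r; lra.
have linZ i t u : a i (t *: u) = t * a i u by rewrite -(addr0 (t *: u)) lin a0 addr0.
pose act x := [set i | a i x == b i]%SET.
pose vertex J x := [/\ forall i, a i x <= b i, act x = J &
  forall d, (forall i, i \in J -> a i d = 0) -> d = 0].
pose vs := [seq xget 0 (vertex J) | J <- enum {set I} & `[< vertex J !=set0 >]].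
have vsP v : v \in vs -> exists J, vertex J v.
  case/mapP => J; rewrite mem_filter => /andP[/asboolP[x Jx] _] ->.
  by exists J; exact: xgetI Jx.
exists vs; split => [v /vsP[J []] //|Q Qconv Qvs x].
have [n] := ubnP #|~: act x|%SET.
elim: n x => // n IH x; rewrite ltnS => xn xS.
have [v_x|] := pselect (vertex (act x) x).
  apply: Qvs; apply/mapP; exists (act x).
    by rewrite mem_filter mem_enum andbT; apply/asboolP; exists x.
  have [wS wact _] := xgetI 0 v_x; move: (xget _ _) wS wact => w wS wact.
  case: v_x => _ _ inj; apply/eqP; rewrite -subr_eq0 addrC -scaleN1r; apply/eqP.
  apply: inj => i xi; rewrite lin mulN1r addrC.
  have := xi; rewrite -wact !inE => /eqP ->.
  by move: xi; rewrite inE => /eqP ->; rewrite subrr.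
move=> nv_x.
have [d dact d0] : exists2 d, (forall i, i \in act x -> a i d = 0) & d <> 0.
  apply: contra_notP nv_x => nd; split => // d dact.
  by apply: contra_notP nd => d0; exists d.
have step e : e <> 0 -> (forall i, i \in act x -> a i e = 0) ->
    exists t, 0 < t /\ Q (t *: e + x).
  move=> e0 eact; have [||t [t0 tS tact]] := polytope_step (d := e) lin xS.
  - by move=> i xi; apply: eact; rewrite inE xi.
  - apply: contra_notP e0 => npos; apply: rec => i.
    by rewrite leNgt; apply/negP => ei; apply: npos; exists i.
  - exists t; split => //; apply: IH => //.
    by apply: leq_trans xn; apply: proper_card; rewrite finset.properC.
have [t [t0 Qt]] := step d d0 dact.
have [||s [s0 Qs]] := step (- d).
- by move/eqP; rewrite oppr_eq0 => /eqP.
- by move=> i /dact ai; rewrite -scaleN1r linZ ai mulr0.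
(* x = s/(t+s) (x + t d) + t/(t+s) (x - s d) *)
have ts0 : 0 < t + s by exact: addr_gt0.
have -> : x = (s / (t + s)) *: (t *: d + x) + (1 - s / (t + s)) *: (s *: (- d) + x).
  rewrite !scalerDr !scalerA addrACA -scalerDl subrKC scale1r scalerN -scalerBl.
  by rewrite [X in X *: d](_ : _ = 0) ?scale0r ?add0r //; field; rewrite gt_eqF.
apply: Qconv => //; apply/andP; split; first by rewrite divr_ge0 // ltW.
by rewrite ler_pdivrMr // mul1r lerDr ltW.
Qed.

(** * Hoffman's error bound *)

Lemma ler_sum_mem (R : realType) (T : eqType) (s : seq T) (F : T -> R) x :
  (forall y, 0 <= F y) -> x \in s -> F x <= \sum_(y <- s) F y.
Proof.
by move=> F0 xs; rewrite (big_rem x xs) /= lerDl; exact: sumr_ge0.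
Qed.

Lemma sublevel_segment_closed (R : realType) (V : lmodType R) (f : V -> R)
    (r : R) :
    (forall t u v, f (t *: u + v) = t * f u + f v) ->
  segment_closed [set x | f x <= r].
Proof.
move=> lin t u v /andP[t0 t1] /= fu fv.
have f0 : f 0 = 0 by have := lin 1 0 0; rewrite scaler0 addr0 mul1r; lra.
rewrite lin -[(1 - t) *: v]addr0 lin f0.
have := ler_wpM2l t0 fu; rewrite -subr_ge0 in t1.
by have := ler_wpM2l t1 fv; lra.
Qed.

(** Hoffman's error bound, relative to a polytope Y = {a y <= b}.  The pairs
    (y, s) with y in Y, 0 <= s <= 1 and G y <= h + s form a polytope, on which
    the property that y is at distance at most C s from P = {y in Y | G y <= h}
    is convex.  It then suffices to have it at the vertices: where s = 0 the
    point y is in P, and the finitely many vertices with s > 0 are accommodated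
    by the choice of C. *)
Lemma hoffman_bound (R : realType) n (I K : finType) (a : I -> 'cV[R]_n -> R)
    (b : I -> R) (G : K -> 'cV[R]_n -> R) (h : K -> R) (p0 : 'cV[R]_n) :
    (forall i t u v, a i (t *: u + v) = t * a i u + a i v) ->
    (forall k t u v, G k (t *: u + v) = t * G k u + G k v) ->
    (forall d, (forall i, a i d <= 0) -> d = 0) ->
    (forall i, a i p0 <= b i) -> (forall k, G k p0 <= h k) ->
  exists2 C, 0 <= C & forall y s, (forall i, a i y <= b i) -> 0 <= s ->
    (forall k, G k y <= h k + s) ->
    exists p, [/\ forall i, a i p <= b i, forall k, G k p <= h k &
                  enorm (y - p) <= C * s].
Proof.
move=> alin Glin rec Yp0 Gp0.
have [us [usY Yind]] := polytope_ind b alin rec.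
pose c (i : I + K + bool) (w : 'cV[R]_n * R^o) : R := match i with
  | inl (inl i) => a i w.1 | inl (inr k) => G k w.1 - w.2
  | inr true => w.2 | inr false => - w.2 end.
pose e (i : I + K + bool) : R := match i with
  | inl (inl i) => b i | inl (inr k) => h k
  | inr true => 1 | inr false => 0 end.
have clin i t u v : c i (t *: u + v) = t * c i u + c i v.
  case: i => [[i|k]|[]] //=.
    by rewrite (Glin k t u.1 v.1) mulrBr opprD addrACA.
  by rewrite mulrN opprD.
have crec d : (forall i, c i d <= 0) -> d = 0.
  case: d => d s H.
  have /= s0 := H (inr true); have /= s0' := H (inr false).
  have {}s0 : s = 0 by apply/le_anti; rewrite s0 -oppr_le0.
  by congr pair => //; apply: rec => i; exact: (H (inl (inl i))).
have [vs [vsP Pind]] := polytope_ind e clin crec.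
(* D bounds the distance from p0 to the points of Y. *)
pose D := \sum_(u <- us) enorm (u - p0).
pose E := \sum_(v <- vs) enorm (v.1 - p0) / `|v.2|.
have E0 v : 0 <= enorm (v.1 - p0) / `|v.2 : R| by rewrite divr_ge0 ?enorm_ge0.
have D0 : 0 <= D by apply: sumr_ge0 => u _; exact: enorm_ge0.
have D_Y y : (forall i, a i y <= b i) -> enorm (y - p0) <= D.
  apply: (Yind (fun y => enorm (y - p0) <= D)); last first.
    by move=> v /(ler_sum_mem (F := fun u => enorm (u - p0))); apply=> u; exact: enorm_ge0.
  move=> t u v /andP[t0 t1] uD vD.
  have -> : t *: u + (1 - t) *: v - p0 = t *: (u - p0) + (1 - t) *: (v - p0).
    by apply/matrixP => i j; rewrite !mxE; ring.
  apply: le_trans (ler_enormD _ _) _; rewrite !enormZ !ger0_norm ?subr_ge0 //.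
  have := ler_wpM2l t0 uD; rewrite -subr_ge0 in t1.
  by have := ler_wpM2l t1 vD; lra.
pose Q (C : R) (w : 'cV[R]_n * R^o) := exists p,
  [/\ forall i, a i p <= b i, forall k, G k p <= h k & enorm (w.1 - p) <= C * w.2].
have Qconv C : segment_closed (Q C).
  move=> t u v /andP[t0 t1] [p [Yp Gp up]] [q [Yq Gq vq]].
  have t01 : 0 <= t <= 1 by rewrite t0.
  exists (t *: p + (1 - t) *: q); split=> [i|k|].
  - exact: (sublevel_segment_closed (alin i) t01 (Yp i) (Yq i)).
  - exact: (sublevel_segment_closed (Glin k) t01 (Gp k) (Gq k)).
  rewrite /= opprD addrACA -!scalerBr.
  apply: le_trans (ler_enormD _ _) _; rewrite !enormZ !ger0_norm ?subr_ge0 //.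
  have := ler_wpM2l t0 up; rewrite -subr_ge0 in t1.
  have := ler_wpM2l t1 vq; rewrite -![_ *: _]/(_ * _); lra.
have Q_P w : (forall i, c i w <= e i) -> Q E w.
  apply: Pind; first exact: Qconv.
  move=> v v_vs; have vP := vsP v v_vs.
  have /= v0 := vP (inr false); rewrite oppr_le0 in v0.
  have [vz|vp] := eqVneq v.2 0.
    exists v.1; split=> [i|k|]; first exact: (vP (inl (inl i))).
      by have /= := vP (inl (inr k)); rewrite vz subr0.
    by rewrite subrr enorm0 vz mulr0.
  (* E is large enough for p0 to serve at every vertex with s > 0. *)
  exists p0; split => //.
  have {}vp : 0 < v.2 by rewrite lt_neqAle eq_sym vp v0.
  rewrite -ler_pdivrMr // -[X in _ / X]gtr0_norm //.
  exact: (ler_sum_mem (F := fun v : 'cV[R]_n * R^o => enorm (v.1 - p0) / `|v.2|)).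
have Ege : 0 <= E by exact: sumr_ge0.
exists (D + E) => [|y s Yy s0 Gy]; first exact: addr_ge0.
(* Violations s > 1 are outside the lifted polytope; there p0 is close enough. *)
have [s1|s1] := leP s 1.
  have [|p [Yp Gp yp]] := Q_P (y, s).
    by case=> [[i|k]|[]] //=; rewrite ?oppr_le0 // lerBlDr.
  exists p; split => //; apply: le_trans yp _; apply: ler_wpM2r => //.
  by rewrite lerDr.
exists p0; split => //; apply: le_trans (D_Y y Yy) _.
apply: (@le_trans _ _ (D + E)); first by rewrite lerDl.
by apply: ler_peMr; rewrite ?addr_ge0 // ltW.
Qed.

(** * Saddle points of the perturbed game *)

Definition convex_body (R : realType) k (S : set 'cV[R]_k) : Prop :=
  [/\ closed S, bounded_set S, segment_closed S & S !=set0].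

Lemma convex_body_proj (R : realType) k (S : set 'cV[R]_k) a :
  convex_body S -> S (Defs.proj S a).
Proof. by case=> cS bS _ S0; case: (argmin_proj a cS bS S0). Qed.

Lemma convex_body_obtuse (R : realType) k (S : set 'cV[R]_k) a x :
  convex_body S -> S x -> dot (a - Defs.proj S a) (x - Defs.proj S a) <= 0.
Proof. by case=> cS bS sS _; exact: proj_obtuse. Qed.

Lemma polytope_convex_body (R : realType) k (S : set 'cV[R]_k) :
  polytope S -> S !=set0 -> convex_body S.
Proof.
case=> pS bS S0; split => //; first exact: polyhedron_closed.
exact: polyhedron_segment_closed.
Qed.

Lemma lipschitz_argmin_closed (R : realType) k (S : set 'cV[R]_k)
    (g : 'cV[R]_k -> R) (L : R) :
    closed S -> 0 <= L -> (forall x x', g x - g x' <= L * enorm (x - x')) ->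
  closed (argmin S g).
Proof.
move=> cS L0 gL; have [[x [Sx xmin]]|no_min] := pselect (argmin S g !=set0).
  rewrite (_ : argmin S g = S `&` [set x' | g x' <= g x]).
    by apply: closedI => //; exact: lipschitz_closed_le gL.
  apply/seteqP; split => x' [Sx' x'min]; split => //; first exact: x'min.
  by move=> w /xmin; exact: le_trans.
by move/set0P/negP: no_min; rewrite negbK => /eqP ->; exact: closed0.
Qed.

(** The first-order form of a saddle point of x^T A y + mu/2 |x|^2: minus
    F_mu (x, y) is a normal vector of X * Y at (x, y). *)
Definition saddle (R : realType) m n (A : 'M[R]_(m, n)) (X : set 'cV[R]_m)
    (Y : set 'cV[R]_n) (mu : R) (x : 'cV[R]_m) (y : 'cV[R]_n) : Prop :=
  [/\ X x, Y y, forall x', X x' -> 0 <= dot (A *m y + mu *: x) (x' - x) &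
      forall y', Y y' -> dot x (A *m (y' - y)) <= 0].

(** The minimizer over X of x^T A y + mu/2 |x|^2, which is
    mu/2 |x + A y / mu|^2 up to a constant. *)
Definition best_response (R : realType) m n (A : 'M[R]_(m, n))
    (X : set 'cV[R]_m) (mu : R) (y : 'cV[R]_n) : 'cV[R]_m :=
  Defs.proj X (- mu^-1 *: (A *m y)).

Definition dual_value (R : realType) m n (A : 'M[R]_(m, n))
    (X : set 'cV[R]_m) (mu : R) (y : 'cV[R]_n) : R :=
  perturbed_payoff A mu (best_response A X mu y) y.

Lemma best_response_stationary (R : realType) m n (A : 'M[R]_(m, n))
    (X : set 'cV[R]_m) (mu : R) (y : 'cV[R]_n) (x' : 'cV[R]_m) :
    convex_body X -> 0 < mu -> X x' ->
  0 <= dot (A *m y + mu *: best_response A X mu y)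
           (x' - best_response A X mu y).
Proof.
move=> hX mu0 Xx'; rewrite /best_response.
have := convex_body_obtuse (- mu^-1 *: (A *m y)) hX Xx'.
move: (Defs.proj _ _) => p; rewrite -(ler_pM2l mu0) mulr0 -dotZl scalerBr scalerA.
rewrite mulrN divff ?gt_eqF // scaleN1r -opprD dotNl => H; lra.
Qed.

Lemma perturbed_payoff_expand (R : realType) m n (A : 'M[R]_(m, n)) (mu : R)
    (x x' : 'cV[R]_m) (y : 'cV[R]_n) :
  perturbed_payoff A mu x' y = perturbed_payoff A mu x y +
    dot (A *m y + mu *: x) (x' - x) + mu / 2 * enorm (x' - x) ^+ 2.
Proof.
rewrite /perturbed_payoff !payoffE !enorm_sqr !dotE.
rewrite !(dotC (A *m y)) (dotC x' x); lra.
Qed.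

Lemma perturbed_payoff_stationary (R : realType) m n (A : 'M[R]_(m, n))
    (mu : R) (x x' : 'cV[R]_m) (y : 'cV[R]_n) : 0 < mu ->
    0 <= dot (A *m y + mu *: x) (x' - x) ->
  perturbed_payoff A mu x y <= perturbed_payoff A mu x' y.
Proof.
move=> mu0 H; rewrite (perturbed_payoff_expand A mu x x') -addrA lerDl.
by rewrite addr_ge0 // mulr_ge0 ?sqr_ge0 // divr_ge0 // ltW.
Qed.

Lemma argmin_best_response (R : realType) m n (A : 'M[R]_(m, n))
    (X : set 'cV[R]_m) (mu : R) (y : 'cV[R]_n) : convex_body X -> 0 < mu ->
  argmin X (fun x => perturbed_payoff A mu x y) (best_response A X mu y).
Proof.
move=> hX mu0; split => [|x' Xx']; first exact: convex_body_proj.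
by apply: perturbed_payoff_stationary => //; exact: best_response_stationary.
Qed.

Lemma perturbed_payoffB (R : realType) m n (A : 'M[R]_(m, n)) (mu : R) x y y' :
  perturbed_payoff A mu x y - perturbed_payoff A mu x y' = dot x (A *m (y - y')).
Proof. by rewrite /perturbed_payoff !payoffE mulmxBr dotDr dotNr; lra. Qed.

Lemma dual_value_lipschitz (R : realType) m n (A : 'M[R]_(m, n))
    (X : set 'cV[R]_m) (mu : R) : convex_body X -> 0 < mu ->
  exists2 L, 0 <= L & forall y y',
    dual_value A X mu y - dual_value A X mu y' <= L * enorm (y - y').
Proof.
move=> hX mu0; have [_ bX _ _] := hX; have [M M0 XM] := enorm_bounded bX.
exists (spectral_norm A * M) => [|y y'].
  by rewrite mulr_ge0 ?spectral_norm_ge0.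
have [Xx' _] := argmin_best_response A y' hX mu0.
have [_ xmin] := argmin_best_response A y hX mu0.
apply: (@le_trans _ _ (dot (best_response A X mu y') (A *m (y - y')))).
  by rewrite -(perturbed_payoffB A mu) /dual_value lerD2r; exact: xmin.
apply: le_trans (dot_mulmx_le _ _ _) _; apply: ler_wpM2r; first exact: enorm_ge0.
by apply: ler_wpM2l; [exact: spectral_norm_ge0|exact: XM].
Qed.

Lemma best_response_lipschitz (R : realType) m n (A : 'M[R]_(m, n))
    (X : set 'cV[R]_m) (mu : R) y y' : convex_body X -> 0 < mu ->
  mu * enorm (best_response A X mu y - best_response A X mu y')
    <= spectral_norm A * enorm (y - y').
Proof.
move=> hX mu0.
have Xx := convex_body_proj (- mu^-1 *: (A *m y)) hX.
have Xx' := convex_body_proj (- mu^-1 *: (A *m y')) hX.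
have := best_response_stationary A y hX mu0 Xx'.
have := best_response_stationary A y' hX mu0 Xx.
rewrite -![Defs.proj _ _]/(best_response _ _ _ _).
move: (best_response _ _ _ y) (best_response _ _ _ y') => x x' H' H.
have [->|xx'] := eqVneq x x'.
  by rewrite subrr enorm0 mulr0 mulr_ge0 ?spectral_norm_ge0 ?enorm_ge0.
have xp : 0 < enorm (x - x').
  rewrite lt_neqAle enorm_ge0 andbT; apply: contraNneq xx' => /esym/enorm_eq0/eqP.
  by rewrite subr_eq0.
have K := dot_mulmx_le A (x' - x) (y - y').
rewrite -(ler_pM2r xp); apply: le_trans (_ : _ <= dot (x' - x) (A *m (y - y'))) _.
  rewrite -mulrA -expr2 enorm_sqr mulmxBr.
  move: H H'; rewrite !dotE !(dotC (A *m _)) (dotC x' x) => H H'; lra.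
by apply: le_trans K _; rewrite (enormB x') mulrAC.
Qed.

(** Envelope argument, which gives strong duality without a minimax theorem.
    Let f be the perturbed payoff and h y = min_x f (x, y).  If y maximizes h
    and y' is another point of Y, then for y_t = y + t (y' - y) and x_t the best
    response to y_t, f (x_t, y_t) = h y_t <= h y <= f (x_t, y), hence
    x_t^T A (y' - y) <= 0.  As t tends to 0, x_t tends to the best response to
    y, at the rate given by best_response_lipschitz. *)
Lemma argmax_dual_value_saddle (R : realType) m n (A : 'M[R]_(m, n))
    (X : set 'cV[R]_m) (Y : set 'cV[R]_n) (mu : R) y :
    convex_body X -> convex_body Y -> 0 < mu ->
  argmax Y (dual_value A X mu) y -> saddle A X Y mu (best_response A X mu y) y.
Proof.
move=> hX [_ _ sY _] mu0 [Yy ymax]; split => // [|x' Xx'|y' Yy'].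
- exact: convex_body_proj.
- exact: best_response_stationary.
pose L := spectral_norm A / mu * enorm (y' - y) * enorm (A *m (y' - y)).
apply: (@le0_of_small_le _ _ L) => t t0 t1.
have t01 : 0 <= t <= 1 by rewrite t1 ltW.
have := ymax _ (sY t y' y t01 Yy' Yy).
have : t *: y' + (1 - t) *: y - y = t *: (y' - y).
  by apply/matrixP => i j; rewrite !mxE; ring.
move: (_ + (1 - t) *: y) => yt ytE ht.
have [Xt _] := argmin_best_response A yt hX mu0.
have [_ /(_ _ Xt) hy] := argmin_best_response A y hX mu0.
have lip := best_response_lipschitz A y yt hX mu0.
rewrite (enormB y) ytE enormZ gtr0_norm // in lip.
have := le_trans ht hy; rewrite -subr_le0 /dual_value perturbed_payoffB ytE.
move: (best_response _ _ _ yt) (best_response _ _ _ y) lip {Xt hy} => xt x lip.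
rewrite -(scalemxAr t A) dotZr (pmulr_rle0 _ t0) => Ht.
have := dot_le (x - xt) (A *m (y' - y)); rewrite dotDl dotNl => K.
apply: le_trans (_ : _ <= enorm (x - xt) * enorm (A *m (y' - y))) _.
  by apply: le_trans K; rewrite lerDl oppr_ge0.
rewrite /L !mulrA; apply: ler_wpM2r; first exact: enorm_ge0.
rewrite -(ler_pM2l mu0); apply: le_trans lip _.
by rewrite le_eqVlt; apply/orP; left; apply/eqP; field; rewrite gt_eqF.
Qed.

Lemma payoff_bounded (R : realType) m n (A : 'M[R]_(m, n)) (Y : set 'cV[R]_n) x :
  bounded_set Y -> has_ubound [set payoff A x y | y in Y].
Proof.
move=> bY; have [M M0 YM] := enorm_bounded bY.
exists (spectral_norm A * enorm x * M) => _ [y Yy <-]; rewrite payoffE.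
apply: le_trans (dot_mulmx_le _ _ _) _; apply: ler_wpM2l; last exact: YM.
by rewrite mulr_ge0 ?spectral_norm_ge0 ?enorm_ge0.
Qed.

(** By strong convexity, the minimax objective at x' exceeds its value at the
    saddle point by at least mu/2 |x' - x|^2, so x is the only minimizer. *)
Lemma saddle_x_mu (R : realType) m n (A : 'M[R]_(m, n))
    (X : set 'cV[R]_m) (Y : set 'cV[R]_n) (mu : R) x y :
    convex_body Y -> 0 < mu -> saddle A X Y mu x y -> x_mu A X Y mu = x.
Proof.
move=> [_ bY _ _] mu0 [Xx Yy xs ys].
have maxE : max_over Y (perturbed_payoff A mu x) = perturbed_payoff A mu x y.
  by apply: max_over_argmax; split => // y' /ys; rewrite -(perturbed_payoffB A mu) subr_le0.
have ge x' : X x' -> perturbed_payoff A mu x y + mu / 2 * enorm (x' - x) ^+ 2 <=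
    max_over Y (perturbed_payoff A mu x').
  move=> Xx'; apply: (@le_trans _ _ (perturbed_payoff A mu x' y)).
    by rewrite (perturbed_payoff_expand A mu x x') lerD2r lerDl xs.
  apply: ub_le_sup; last by exists y.
  have [B HB] := payoff_bounded A x' bY.
  exists (B + mu / 2 * enorm x' ^+ 2) => _ [w Yw <-].
  by rewrite lerD2r; apply: HB; exists w.
have xmin : minimax_set X Y (perturbed_payoff A mu) x.
  split => // x' /ge; rewrite maxE; apply: le_trans; rewrite lerDl.
  by rewrite mulr_ge0 ?sqr_ge0 // divr_ge0 // ltW.
have [Xw /(_ _ Xx)] := xgetI 0 xmin; rewrite -[xget _ _]/(x_mu A X Y mu) in Xw *.
rewrite maxE => /(le_trans (ge _ Xw)); rewrite gerDl pmulr_rle0 ?divr_gt0 //.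
move=> w0; apply/eqP; rewrite -subr_eq0; apply/eqP/dot_eq0.
by rewrite -enorm_sqr; apply/le_anti; rewrite w0 sqr_ge0.
Qed.

Lemma Y_muE (R : realType) m n (A : 'M[R]_(m, n))
    (X : set 'cV[R]_m) (Y : set 'cV[R]_n) (mu : R) : convex_body X -> 0 < mu ->
  Y_mu A X Y mu = argmax Y (dual_value A X mu).
Proof.
move=> hX mu0; rewrite /Y_mu /maximin_set; congr argmax; apply/funext => y.
exact: min_over_argmin (argmin_best_response A y hX mu0).
Qed.

Lemma Y_mu_neq0 (R : realType) m n (A : 'M[R]_(m, n))
    (X : set 'cV[R]_m) (Y : set 'cV[R]_n) (mu : R) :
  convex_body X -> convex_body Y -> 0 < mu -> Y_mu A X Y mu !=set0.
Proof.
move=> hX [cY bY _ Y0] mu0; have [L L0 hL] := dual_value_lipschitz A hX mu0.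
rewrite (Y_muE A Y hX mu0); have [|y [Yy ymin]] :=
    lipschitz_argmin (g := fun y => - dual_value A X mu y) cY bY Y0 L0.
  by move=> y y'; rewrite opprK addrC (enormB y).
by exists y; split; [exact: Yy|move=> y' /ymin; rewrite lerN2].
Qed.

Lemma Y_muP (R : realType) m n (A : 'M[R]_(m, n))
    (X : set 'cV[R]_m) (Y : set 'cV[R]_n) (mu : R) y :
    convex_body X -> convex_body Y -> 0 < mu ->
  Y_mu A X Y mu y <-> saddle A X Y mu (x_mu A X Y mu) y.
Proof.
move=> hX hY mu0; rewrite (Y_muE A Y hX mu0); split=> [yh|].
  have sd := argmax_dual_value_saddle hX hY mu0 yh.
  by rewrite (saddle_x_mu hY mu0 sd).
move: (x_mu _ _ _ _) => x [Xx Yy xs ys]; split=> [|y' Yy']; first exact: Yy.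
have [_ /(_ _ Xx) h'] := argmin_best_response A y' hX mu0.
have [Xb _] := argmin_best_response A y hX mu0.
apply: le_trans h' _; apply: le_trans (_ : _ <= perturbed_payoff A mu x y) _.
  by rewrite -subr_le0 perturbed_payoffB ys.
by apply: perturbed_payoff_stationary => //; exact: xs.
Qed.

Lemma Z_mu_nearest (R : realType) m n (A : 'M[R]_(m, n))
    (X : set 'cV[R]_m) (Y : set 'cV[R]_n) (mu : R) z :
    convex_body X -> convex_body Y -> 0 < mu ->
  argmin (Z_mu A X Y mu) (fun p => enorm (z - p)) !=set0.
Proof.
move=> hX hY mu0; have Y0 := Y_mu_neq0 A hX hY mu0.
have [cY bY _ _] := hY; have [L L0 hL] := dual_value_lipschitz A hX mu0.
have cYmu : closed (Y_mu A X Y mu).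
  rewrite (Y_muE A Y hX mu0) (_ : argmax _ _ = argmin Y (fun y => - dual_value A X mu y)).
    by apply: lipschitz_argmin_closed cY L0 _ => y y'; rewrite opprK addrC (enormB y).
  by apply/seteqP; split => y [Yy H];
    (split; first exact: Yy) => y' /H; rewrite lerN2.
have bYmu : bounded_set (Y_mu A X Y mu).
  case: bY => M [Mr HM]; exists M; split => // M' MM' y [Yy _]; exact: HM _ MM' _ Yy.
have [|y [Yy ymin]] := lipschitz_argmin
    (g := fun y => enorm (z - col_mx (x_mu A X Y mu) y)) cYmu bYmu Y0 ler01.
  move=> y y'; rewrite mul1r lerBlDl.
  apply: le_trans (ler_enormB _ (col_mx (x_mu A X Y mu) y') _) _.
  rewrite lerD2l opp_col_mx add_col_mx subrr; apply: le_trans (enorm_col_mx_le _ _) _.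
  by rewrite enorm0 add0r enormB.
exists (col_mx (x_mu A X Y mu) y); split; first by exists (x_mu A X Y mu) => //; exists y.
by move=> _ [x -> [y' /ymin + <-]].
Qed.

(** * The error bound for the perturbed game *)

Lemma polytope_constraints (R : realType) k (S : set 'cV[R]_k) :
    polytope S -> S !=set0 ->
  exists (p : nat) (a : 'I_p -> 'cV[R]_k -> R) (b : 'I_p -> R),
    [/\ forall i t u v, a i (t *: u + v) = t * a i u + a i v,
        forall x, S x <-> forall i, a i x <= b i &
        forall d, (forall i, a i d <= 0) -> d = 0].
Proof.
case=> [[p [B [b SE]]] bS] [x0 Sx0].
exists p, (fun i x => (B *m x) i 0), (fun i => b i 0); split => [i t u v|x|d dB].
- by rewrite mulmxDr -scalemxAr mxE [X in X + _]mxE.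
- by rewrite SE.
have [M M0 SM] := enorm_bounded bS; apply: enorm_eq0.
apply/le_anti; rewrite enorm_ge0 andbT leNgt; apply/negP => d0.
pose t := (M + M + 1) / enorm d.
have t0 : 0 <= t by rewrite divr_ge0 ?enorm_ge0 // !addr_ge0.
have Sx : S (t *: d + x0).
  rewrite SE /= => i; rewrite mulmxDr -scalemxAr mxE [X in X + _]mxE.
  have := Sx0; rewrite SE => /(_ i); have := ler_wpM2l t0 (dB i); lra.
have := ler_enormD (t *: d + x0) (- x0); rewrite addrK enormN enormZ ger0_norm //.
rewrite divfK ?gt_eqF // leNgt; apply/negP; rewrite negbK.
have := SM _ Sx; have := SM _ Sx0; lra.
Qed.

Lemma quadratic_residual_bound (R : realType) (d r E : R) :
    0 <= d -> 0 <= r -> 0 <= E -> d ^+ 2 <= E * r * (r + d) ->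
  d <= (1 + E) * r.
Proof.
move=> d0 r0 E0 H; rewrite leNgt; apply/negP => dr.
have Er : 0 <= E * r by exact: mulr_ge0.
have dp : 0 < d by apply: le_lt_trans dr; rewrite mulrDl mul1r addr_ge0.
have := ler_wpM2l Er (ltW dr); have : (1 + E) * r * d < d * d by rewrite ltr_pM2r.
have := ler_wpM2l r0 (ltW dr).
have : 0 <= E * r ^+ 2 by rewrite mulr_ge0 ?sqr_ge0.
have : 0 <= r ^+ 2 by exact: sqr_ge0.
move: H; rewrite !expr2 => H; lra.
Qed.

(** Y_mu is cut out of Y by finitely many linear inequalities, because the
    stationarity of x_mu need only be tested at the vertices of X.  Hoffman's
    bound therefore applies to a point y that satisfies the saddle inequalities
    up to s. *)
Lemma Y_mu_error_bound (R : realType) m n (A : 'M[R]_(m, n))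
    (X : set 'cV[R]_m) (Y : set 'cV[R]_n) (mu : R) :
    polytope X -> polytope Y -> X !=set0 -> Y !=set0 -> 0 < mu ->
  exists2 C, 0 <= C & forall y s, Y y -> 0 <= s ->
    (forall x', X x' -> - s <= dot (A *m y + mu *: x_mu A X Y mu) (x' - x_mu A X Y mu)) ->
    (forall y', Y y' -> dot (x_mu A X Y mu) (A *m (y' - y)) <= s) ->
    exists2 p, Y_mu A X Y mu p & enorm (y - p) <= C * s.
Proof.
move=> pX pY X0 Y0 mu0.
have hX := polytope_convex_body pX X0; have hY := polytope_convex_body pY Y0.
have [y0 Yy0] := Y_mu_neq0 A hX hY mu0.
have [y0Y y0x y0y] : [/\ Y y0, forall x', X x' ->
    0 <= dot (A *m y0 + mu *: x_mu A X Y mu) (x' - x_mu A X Y mu) &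
    forall y', Y y' -> dot (x_mu A X Y mu) (A *m (y' - y0)) <= 0].
  by case/(Y_muP A y0 hX hY mu0): Yy0.
have Xxm : X (x_mu A X Y mu) by case/(Y_muP A y0 hX hY mu0): Yy0.
have P_Y p : Y p -> (forall x', X x' ->
    0 <= dot (A *m p + mu *: x_mu A X Y mu) (x' - x_mu A X Y mu)) ->
    (forall y', Y y' -> dot (x_mu A X Y mu) (A *m (y' - p)) <= 0) ->
    Y_mu A X Y mu p.
  by move=> Yp px py; apply/(Y_muP A p hX hY mu0).
move: (x_mu A X Y mu) Xxm y0x y0y P_Y => xm Xxm y0x y0y P_Y.
have [p [a [b [alin YE arec]]]] := polytope_constraints pY Y0.
have [q [a' [b' [alin' XE arec']]]] := polytope_constraints pX X0.
have [vs [vsX Xind]] := polytope_ind b' alin' arec'.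
(* G k y <= h k is stationarity of x_mu tested at the k-th vertex of X; the
   remaining inequality says that y is as good a reply to x_mu as y0. *)
pose G (k : option 'I_(size vs)) (y : 'cV[R]_n) : R :=
  if k is Some k then - dot (A *m y) (vs`_k - xm) else - dot xm (A *m y).
pose h (k : option 'I_(size vs)) : R :=
  if k is Some k then mu * dot xm (vs`_k - xm) else - dot xm (A *m y0).
have vX (k : 'I_(size vs)) : X vs`_k by apply/XE => i; apply: vsX; exact: mem_nth.
have Glin k t u v : G k (t *: u + v) = t * G k u + G k v.
  by case: k => [k|] /=; rewrite mulmxDr -scalemxAr (dotDl, dotDr) (dotZl, dotZr); lra.
have Gy0 k : G k y0 <= h k.
  case: k => [k|] //=.
  have := y0x _ (vX k); rewrite dotDl dotZl; lra.
have Yy0' i : a i y0 <= b i by apply YE.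
have [C C0 HC] := hoffman_bound alin Glin arec Yy0' Gy0.
exists C => // y s Yy s0 ys ys'; have [||p' [Yp Gp yp]] := HC y s _ s0.
- exact/YE.
- case=> [k|] /=; first by have := ys _ (vX k); rewrite dotDl dotZl; lra.
  by have := ys' _ y0Y; rewrite mulmxBr dotDr dotNr; lra.
exists p' => //; apply: P_Y => [|x' Xx'|y' Yy'].
- exact/YE.
- apply: (Xind (fun x' => 0 <= dot (A *m p' + mu *: xm) (x' - xm))); last exact/XE.
    move=> t u v /andP[t0 t1] u0 v0.
    have -> : t *: u + (1 - t) *: v - xm = t *: (u - xm) + (1 - t) *: (v - xm).
      by apply/matrixP => i j; rewrite !mxE; ring.
    by rewrite dotDr !dotZr addr_ge0 // mulr_ge0 // subr_ge0.
  move=> v v_vs; have iv : (index v vs < size vs)%N by rewrite index_mem.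
  have /= := Gp (Some (Ordinal iv)); rewrite nth_index // dotDl dotZl; lra.
have := Gp None; have := y0y _ Yy'; rewrite /= !mulmxBr !dotDr !dotNr; lra.
Qed.

(** The residual controls the distance linearly although the game is quadratic
    in x.  Let r be the norm of the residual w at z = (x, y) and d = |x - x_mu|.
    The saddle inequalities at (x_mu, y) are violated by O(r + d), so
    Y_mu_error_bound gives p in Y_mu with |y - p| = O(r + d).  Strong
    monotonicity in x gives mu d^2 <= w.(z - (x_mu, p)) <= r O(r + d), whence
    d = O(r). *)
Lemma perturbed_error_bound (R : realType) m n (A : 'M[R]_(m, n))
    (X : set 'cV[R]_m) (Y : set 'cV[R]_n) (mu : R) :
    polytope X -> polytope Y -> X !=set0 -> Y !=set0 -> 0 < mu ->
  exists2 c, 0 < c & forall z v, prod_set X Y z ->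
    normal_cone (prod_set X Y) z v ->
    dist z (Z_mu A X Y mu) <= c * enorm (F_mu A mu z + v).
Proof.
move=> pX pY X0 Y0 mu0.
have hX := polytope_convex_body pX X0; have hY := polytope_convex_body pY Y0.
have [C C0 HC] := Y_mu_error_bound A pX pY X0 Y0 mu0.
have [MX MX0 XM] := enorm_bounded pX.2; have [MY MY0 YM] := enorm_bounded pY.2.
pose a := spectral_norm A; have a0 : 0 <= a := spectral_norm_ge0 A.
(* C1 dominates the coefficients of r and d in the violations of the two saddle
   inequalities, estimated below from the normal cone inequality nc. *)
pose C1 := 2 * MY + 2 * a * MY + 2 * MX + a * MY + 3 * mu * MX.
have C10 : 0 <= C1 by rewrite /C1 !addr_ge0 // !mulr_ge0 // ltW.
pose B := 1 + C * C1; have B0 : 0 < B by rewrite ltr_pwDl // mulr_ge0.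
pose E := B / mu; have E0 : 0 < E by exact: divr_gt0.
exists (B * (2 + E)) => [|z v [x Xx [y Yy <-]] zv].
  by rewrite mulr_gt0 // addr_gt0.
have [y0 Yy0] := Y_mu_neq0 A hX hY mu0.
have Xxm : X (x_mu A X Y mu) by case/(Y_muP A y0 hX hY mu0): Yy0.
have Zdist p : Y_mu A X Y mu p -> dist (col_mx x y) (Z_mu A X Y mu)
    <= enorm (col_mx x y - col_mx (x_mu A X Y mu) p).
  move=> Yp; apply: dist_le; first exact: Z_mu_nearest.
  by exists (x_mu A X Y mu) => //; exists p.
have Psad p : Y_mu A X Y mu p -> Y p /\
   0 <= dot (A *m p + mu *: x_mu A X Y mu) (x - x_mu A X Y mu) /\
   dot (x_mu A X Y mu) (A *m (y - p)) <= 0.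
  by case/(Y_muP A p hX hY mu0) => _ Yp H H'; split=> //; split; [exact: H|exact: H'].
move: (dist _ _) Zdist => D Zdist.
move: (x_mu A X Y mu) Xxm Zdist HC Psad => xm Xxm Zdist HC Psad {Yy0 y0}.
have vE : v = F_mu A mu (col_mx x y) + v - F_mu A mu (col_mx x y).
  by rewrite addrC addKr.
move: vE; move: (F_mu A mu (col_mx x y) + v) => w.
rewrite /F_mu col_mxKu col_mxKd -(vsubmxK w).
move: (usubmx w) (dsubmx w) => wx wy; rewrite opp_col_mx add_col_mx opprK => vE.
have nc x' y' : X x' -> Y y' -> dot (wx - (A *m y + mu *: x)) (x' - x) +
    (dot wy (y' - y) + dot x (A *m (y' - y))) <= 0.
  move=> Xx' Yy'; have : prod_set X Y (col_mx x' y').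
    by exists x' => //; exists y'.
  move/zv; rewrite vE opp_col_mx add_col_mx dot_col_mx.
  by rewrite [dot (wy + _) _]dotDl dot_trmx.
set r := enorm (col_mx wx wy); have r0 : 0 <= r by exact: enorm_ge0.
have wxr : enorm wx <= r by exact: enorm_usub_le.
have wyr : enorm wy <= r by exact: enorm_dsub_le.
pose d := enorm (x - xm); have d0 : 0 <= d by exact: enorm_ge0.
have dotlb k (u u' : 'cV[R]_k) s t :
    enorm u <= s -> enorm u' <= t -> - (s * t) <= dot u u'.
  move=> us ut; rewrite lerNl -dotNl; apply: le_trans (dot_le _ _) _.
  by rewrite enormN ler_pM ?enorm_ge0.
have diam k (S : set 'cV[R]_k) M u u' : (forall u, S u -> enorm u <= M) ->
    S u -> S u' -> enorm (u - u') <= 2 * M.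
  move=> SM Su Su'; apply: le_trans (ler_enormD _ _) _; rewrite enormN.
  by have := SM _ Su; have := SM _ Su'; lra.
have Anorm u M : enorm u <= M -> enorm (A *m u) <= a * M.
  by move=> uM; apply: le_trans (ler_spectral_norm _ _) _; rewrite ler_wpM2l.
pose s := C1 * (r + d); have rd0 : 0 <= r + d by exact: addr_ge0.
have s0 : 0 <= s by exact: mulr_ge0.
have xmd : enorm (xm - x) <= d by rewrite enormB.
have s_ge c1 c2 : c1 <= C1 -> c2 <= C1 -> c1 * r + c2 * d <= s.
  by move=> H1 H2; rewrite /s mulrDr lerD // ler_wpM2r.
have aMY := mulr_ge0 a0 MY0; have muMX := mulr_ge0 (ltW mu0) MX0.
have [||p Yp yp] := HC y s Yy s0.
- move=> x' Xx'; have := nc x' y Xx' Yy.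
  rewrite subrr mulmx0 !dot0r !addr0 dotDl dotNl => H1.
  have H2 := dotlb _ _ _ _ _ wxr (diam _ _ _ _ _ XM Xx' Xx).
  have H3 : - ((a * MY + mu * MX) * d) <= dot (A *m y + mu *: x) (x - xm).
    apply: dotlb => //; apply: le_trans (ler_enormD _ _) _; apply: lerD.
      exact/Anorm/YM.
    by rewrite enormZ gtr0_norm // ler_pM2l // XM.
  have H4 := dotlb _ _ _ _ _ xmd (diam _ _ _ _ _ XM Xx' Xxm).
  have H5 : 2 * MX * r + (a * MY + mu * MX + 2 * (mu * MX)) * d <= s.
    by apply: s_ge; rewrite /C1; lra.
  have -> : dot (A *m y + mu *: xm) (x' - xm) = dot (A *m y + mu *: x) (x' - x) +
      dot (A *m y + mu *: x) (x - xm) + mu * dot (xm - x) (x' - xm).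
    by rewrite !dotE !(dotC (A *m _)) (dotC x xm); ring.
  have {}H4 := ler_wpM2l (ltW mu0) H4; lra.
- move=> y' Yy'; have := nc x y' Xx Yy'.
  rewrite subrr dot0r add0r => H1.
  have yy' := diam _ _ _ _ _ YM Yy' Yy.
  have H2 := dotlb _ _ _ _ _ wyr yy'.
  have xmd' : enorm (x - xm) <= d by [].
  have H3 := dotlb _ _ _ _ _ xmd' (Anorm _ _ yy').
  have H4 : 2 * MY * r + 2 * (a * MY) * d <= s by apply: s_ge; rewrite /C1; lra.
  move: H3; rewrite dotDl dotNl; lra.
have zp : enorm (col_mx x y - col_mx xm p) <= B * (r + d).
  rewrite opp_col_mx add_col_mx; apply: le_trans (enorm_col_mx_le _ _) _.
  by have := yp; rewrite -/d /s /B; lra.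
have mono : mu * d ^+ 2 <= r * (B * (r + d)).
  apply: le_trans (_ : _ <= r * enorm (col_mx x y - col_mx xm p)) _; last first.
    by apply: ler_wpM2l.
  have [Y_p [H1 H2]] := Psad p Yp.
  have H3 := nc xm p Xxm Y_p.
  apply: le_trans (dot_le _ _); rewrite /d enorm_sqr opp_col_mx add_col_mx dot_col_mx.
  move: H1 H2 H3; rewrite !mulmxBr !dotE !(dotC (A *m _)) (dotC xm x) => H1 H2 H3.
  lra.
apply: le_trans (Zdist p Yp) _; apply: le_trans zp _.
have dr : d <= (1 + E) * r.
  apply: quadratic_residual_bound => //; first exact: ltW.
  rewrite -(ler_pM2l mu0); apply: le_trans mono _.
  by rewrite le_eqVlt; apply/orP; left; apply/eqP; rewrite /E; field; rewrite gt_eqF.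
rewrite -mulrA ler_pM2l //; lra.
Qed.

(** * Exactness of the perturbation *)

Lemma payoff_argmax (R : realType) m n (A : 'M[R]_(m, n)) (Y : set 'cV[R]_n) x :
  convex_body Y -> argmax Y (payoff A x) !=set0.
Proof.
case=> cY bY _ Y0.
have L0 : 0 <= spectral_norm A * enorm x.
  by rewrite mulr_ge0 ?spectral_norm_ge0 ?enorm_ge0.
have [|y [Yy ymin]] := lipschitz_argmin (g := fun y => - payoff A x y) cY bY Y0 L0.
  move=> y y'; rewrite !payoffE opprK addrC -dotNr -dotDr -mulmxBr (enormB y).
  exact: dot_mulmx_le.
by exists y; split => // y' /ymin; rewrite lerN2.
Qed.

Lemma max_payoff_ge (R : realType) m n (A : 'M[R]_(m, n)) (Y : set 'cV[R]_n) x y :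
  bounded_set Y -> Y y -> payoff A x y <= max_over Y (payoff A x).
Proof.
by move=> bY Yy; apply: ub_le_sup; [exact: payoff_bounded|exists y].
Qed.

Lemma max_payoff_lipschitz (R : realType) m n (A : 'M[R]_(m, n))
    (Y : set 'cV[R]_n) : convex_body Y ->
  exists2 L, 0 <= L & forall x x',
    max_over Y (payoff A x) - max_over Y (payoff A x') <= L * enorm (x - x').
Proof.
move=> hY; have [_ bY _ _] := hY; have [M M0 YM] := enorm_bounded bY.
exists (spectral_norm A * M) => [|x x'].
  by rewrite mulr_ge0 ?spectral_norm_ge0.
have [y xy] := payoff_argmax A x hY; rewrite (max_over_argmax xy).
have Yy := xy.1; have := max_payoff_ge A x' bY Yy.
rewrite -lerN2 => /(lerD (lexx (payoff A x y))) /le_trans; apply.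
rewrite !payoffE -dotNl -dotDl; apply: le_trans (dot_mulmx_le _ _ _) _.
rewrite mulrAC; apply: ler_wpM2r; first exact: enorm_ge0.
by apply: ler_wpM2l; [exact: spectral_norm_ge0|exact: YM].
Qed.

Lemma minimax_set_nearest (R : realType) m n (A : 'M[R]_(m, n))
    (X : set 'cV[R]_m) (Y : set 'cV[R]_n) a :
    convex_body X -> convex_body Y ->
  argmin (minimax_set X Y (payoff A)) (fun p => enorm (a - p)) !=set0.
Proof.
move=> [cX bX _ X0] hY; have [L L0 gL] := max_payoff_lipschitz A hY.
exists (Defs.proj (minimax_set X Y (payoff A)) a); apply: argmin_proj.
- exact: lipschitz_argmin_closed cX L0 gL.
- case: bX => M [Mr HM]; exists M; split => // M' MM' x [Xx _]; exact: HM _ MM' _ Xx.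
- exact: lipschitz_argmin cX bX X0 L0 gL.
Qed.

(** Exactness of the perturbation: moving from x_mu to the nearest minimax
    strategy of the original game gains at least alpha times the distance d in
    the payoff, and costs at most mu M d in the regularizer, where M bounds the
    norm on X; as mu M < alpha, d = 0. *)
Lemma x_mu_minimax (R : realType) m n (A : 'M[R]_(m, n)) (X : set 'cV[R]_m)
    (Y : set 'cV[R]_n) (alpha mu : R) :
    convex_body X -> convex_body Y -> 0 < alpha ->
    (forall x, X x -> alpha * dist x (minimax_set X Y (payoff A))
       <= max_over Y (payoff A x) - minimax_value X Y (payoff A)) ->
    0 < mu -> (mu%:E < alpha%:E / (max_over X (fun x => enorm x))%:E)%E ->
  minimax_set X Y (payoff A) (x_mu A X Y mu).
Proof.
move=> hX hY alpha0 growth mu0 mu_lt.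
pose M := max_over X (fun x => enorm x).
have XM x : X x -> enorm x <= M.
  move=> Xx; have [_ bX _ _] := hX; have [B _ XB] := enorm_bounded bX.
  by apply: ub_le_sup; [exists B => _ [w /XB ? <-]|exists x].
have muM : mu * M < alpha.
  have M0 : 0 <= M by have [_ _ _ [x Xx]] := hX; exact: le_trans (enorm_ge0 _) (XM x Xx).
  move: mu_lt; rewrite -/M inver; have [->|Mn0] := eqVneq M 0.
    by rewrite mulr0.
  by rewrite -EFinM lte_fin ltr_pdivlMr // lt_neqAle eq_sym Mn0.
have [y Yy] := Y_mu_neq0 A hX hY mu0; have [_ bY _ _] := hY.
have [Xx Yy' xs ys] : saddle A X Y mu (x_mu A X Y mu) y.
  exact/(Y_muP A y hX hY mu0).
have near := minimax_set_nearest A (x_mu A X Y mu) hX hY.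
apply: (dist_eq0 near); have /= Hg := growth _ Xx.
have [w /(xgetI 0) [+ _]] := near.
rewrite -[xget _ _]/(Defs.proj _ _) => pmin.
rewrite /minimax_value (min_over_argmin pmin) /dist in Hg *.
move: (Defs.proj _ _) pmin Hg => p [Xp _] Hg {near w}.
move: (x_mu A X Y mu) Xx xs ys Hg => xm Xx xs ys.
have d0 := enorm_ge0 (xm - p); have pd := ler_enormD (p - xm) xm.
rewrite subrK (enormB p) in pd.
move: (enorm (xm - p)) d0 pd => d d0 pd Hg.
have [y1 xy1] := payoff_argmax A xm hY; rewrite (max_over_argmax xy1) in Hg.
have := max_payoff_ge A p bY Yy'; have := ys _ xy1.1.
rewrite -(perturbed_payoffB A mu) => H1 H2.
have := perturbed_payoff_stationary mu0 (xs _ Xp).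
move: H1 Hg; rewrite /perturbed_payoff.
move: (payoff A xm y1) (payoff A xm y) (payoff A p y) (max_over _ _) H2.
move=> u1 u2 u3 u4 H2 H1 Hg H3.
have [xM pM] := (XM _ Xx, XM _ Xp); have x0 := enorm_ge0 xm; have p0 := enorm_ge0 p.
have {H1 H2 H3}Hg0 : alpha * d <= mu / 2 * (enorm p ^+ 2 - enorm xm ^+ 2) by lra.
have H : enorm p ^+ 2 - enorm xm ^+ 2 <= d * (2 * M).
  rewrite subr_sqr; apply: le_trans (_ : _ <= d * (enorm p + enorm xm)) _.
    by apply: ler_wpM2r; [exact: addr_ge0|lra].
  by apply: ler_wpM2l => //; lra.
have {}H := ler_wpM2l (ltW mu0) H.
have H0 : (alpha - mu * M) * d <= 0 by lra.
by apply/le_anti; rewrite d0 andbT; rewrite pmulr_rle0 ?subr_gt0 in H0.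
Qed.

(** * Linear convergence *)

(** One step of the iteration decreases the squared distance to any saddle point
    by half the squared step length.  The obtuse-angle inequalities of the two
    projections, added to the variational inequality of the saddle point, leave
    only the cross term 2 eta u.(mu dx + A dy), where u is the new primal error:
    it is absorbed by the strong convexity term 2 eta mu |u|^2 when
    eta <= mu / (mu^2 + |A|^2). *)
Lemma gda_step_descent (R : realType) m n (A : 'M[R]_(m, n)) (X : set 'cV[R]_m)
    (Y : set 'cV[R]_n) (mu eta : R) (x xs x' : 'cV[R]_m) (y ys y' : 'cV[R]_n) :
    convex_body X -> convex_body Y -> 0 < mu -> 0 < eta ->
    eta <= mu / (mu ^+ 2 + spectral_norm A ^+ 2) ->
    saddle A X Y mu xs ys ->
    x' = Defs.proj X (x - eta *: (A *m y + mu *: x)) ->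
    y' = Defs.proj Y (y + eta *: (A^T *m x')) ->
  enorm (col_mx x' y' - col_mx xs ys) ^+ 2 <=
    enorm (col_mx x y - col_mx xs ys) ^+ 2
    - 1 / 2 * enorm (col_mx x' y' - col_mx x y) ^+ 2.
Proof.
move=> hX hY mu0 eta0 eta_le [Xs Ys Hxs Hys] x'E y'E.
have b0 : 0 < mu ^+ 2 + spectral_norm A ^+ 2.
  by rewrite ltr_pwDl ?sqr_ge0 // exprn_gt0.
rewrite ler_pdivlMr // in eta_le.
have Xx' : X x' by rewrite x'E; exact: convex_body_proj.
have Yy' : Y y' by rewrite y'E; exact: convex_body_proj.
have P1 := convex_body_obtuse (x - eta *: (A *m y + mu *: x)) hX Xs.
have P2 := convex_body_obtuse (y + eta *: (A^T *m x')) hY Ys.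
rewrite -x'E in P1; rewrite -y'E in P2.
have S1 := ler_wpM2l (ltW eta0) (Hxs _ Xx'); rewrite mulr0 in S1.
have S2 := ler_wpM2l (ltW eta0) (Hys _ Yy'); rewrite mulr0 in S2.
pose a := spectral_norm A; pose U := enorm (x' - xs).
pose p := enorm (x' - x); pose q := enorm (y' - y).
have K1 := ler_wpM2l (ltW eta0) (ler_wpM2l (ltW mu0) (dot_le (x' - xs) (x' - x))).
have K2 := ler_wpM2l (ltW eta0) (dot_mulmx_le A (x' - xs) (y' - y)).
have K3 := ler_wpM2r (sqr_ge0 U) (ler_wpM2l (ltW eta0) eta_le).
rewrite -/a -/U -/p -/q in K1 K2 K3.
have Q1 : 0 <= (2 * (eta * mu * U) - p) ^+ 2 by exact: sqr_ge0.
have Q2 : 0 <= (2 * (eta * a * U) - q) ^+ 2 by exact: sqr_ge0.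
have cross : 2 * (eta * (mu * dot (x' - xs) (x' - x))
                 + eta * dot (x' - xs) (A *m (y' - y)))
    <= 2 * (eta * mu) * U ^+ 2 + 1 / 2 * (p ^+ 2 + q ^+ 2) by lra.
clear K1 K2 K3 Q1 Q2 x'E y'E.
have col k l (u u' : 'cV[R]_k) (w w' : 'cV[R]_l) :
    enorm (col_mx u w - col_mx u' w') ^+ 2 = enorm (u - u') ^+ 2 + enorm (w - w') ^+ 2.
  by rewrite opp_col_mx add_col_mx !enorm_sqr dot_col_mx.
rewrite !col; move: cross P1 P2 S1 S2; rewrite /U /p /q !enorm_sqr !mulmxBr.
rewrite !dotE !dot_trmx !(dotC (A *m _)) (dotC xs x') (dotC x x') (dotC xs x).
rewrite (dotC ys y') (dotC y y') (dotC ys y) => cross P1 P2 S1 S2.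
lra.
Qed.

(** The two projections provide a normal vector at the new iterate z'; after
    adding F_mu (z'), the terms evaluated at the old and the new iterate cancel
    up to multiples of the step. *)
Lemma gda_step_residual (R : realType) m n (A : 'M[R]_(m, n)) (X : set 'cV[R]_m)
    (Y : set 'cV[R]_n) (mu eta : R) (x x' : 'cV[R]_m) (y y' : 'cV[R]_n) :
    convex_body X -> convex_body Y -> 0 < mu -> 0 < eta ->
    x' = Defs.proj X (x - eta *: (A *m y + mu *: x)) ->
    y' = Defs.proj Y (y + eta *: (A^T *m x')) ->
  exists2 v, normal_cone (prod_set X Y) (col_mx x' y') v &
    enorm (F_mu A mu (col_mx x' y') + v) <=
      (eta^-1 + mu + spectral_norm A) * enorm (col_mx x' y' - col_mx x y).
Proof.
move=> hX hY mu0 eta0 x'E y'E.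
exists (eta^-1 *: col_mx (x - eta *: (A *m y + mu *: x) - x')
                         (y + eta *: (A^T *m x') - y')).
  move=> _ [xs Xs [ys Ys <-]].
  rewrite dotZl pmulr_rle0 ?invr_gt0 // opp_col_mx add_col_mx dot_col_mx.
  have := convex_body_obtuse (x - eta *: (A *m y + mu *: x)) hX Xs.
  have := convex_body_obtuse (y + eta *: (A^T *m x')) hY Ys.
  by rewrite -x'E -y'E => H1 H2; rewrite -[leRHS]addr0 lerD.
rewrite /F_mu col_mxKu col_mxKd.
pose dx := x' - x; pose dy := y' - y.
have -> : col_mx (A *m y' + mu *: x') (- (A^T *m x')) +
    eta^-1 *: col_mx (x - eta *: (A *m y + mu *: x) - x') (y + eta *: (A^T *m x') - y')
    = col_mx (A *m dy + mu *: dx) 0 - eta^-1 *: col_mx dx dy.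
  have e0 : eta != 0 by rewrite gt_eqF.
  rewrite !scale_col_mx opp_col_mx !add_col_mx /dx /dy mulmxBr; congr col_mx.
    move: (A *m y) (A *m y') => w w'.
    by apply/matrixP => i j; rewrite !mxE; field.
  move: (A^T *m x') => w; by apply/matrixP => i j; rewrite !mxE; field.
have -> : col_mx x' y' - col_mx x y = col_mx dx dy by rewrite opp_col_mx add_col_mx.
have H1 := enorm_usub_le dx dy; have H2 := enorm_dsub_le dx dy.
apply: le_trans (ler_enormD _ _) _; rewrite enormN enormZ gtr0_norm ?invr_gt0 //.
suff : enorm (col_mx (A *m dy + mu *: dx) (0 : 'cV_n)) <=
    (mu + spectral_norm A) * enorm (col_mx dx dy) by lra.
apply: le_trans (enorm_col_mx_le _ _) _; rewrite enorm0 addr0 addrC mulrDl.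
apply: le_trans (ler_enormD _ _) _; apply: lerD.
  by rewrite enormZ gtr0_norm // ler_pM2l.
apply: le_trans (ler_spectral_norm _ _) _.
by apply: ler_wpM2l => //; exact: spectral_norm_ge0.
Qed.

Lemma beta_mu_ge (R : realType) m n (A : 'M[R]_(m, n)) (mu eta c : R) :
    0 < mu -> 0 < c -> 0 < eta -> eta <= mu / (mu ^+ 2 + spectral_norm A ^+ 2) ->
  c * (eta^-1 + mu + spectral_norm A) <= beta_mu A mu c / eta.
Proof.
move=> mu0 c0 eta0 eta_le; rewrite /beta_mu; have := spectral_norm_ge0 A.
move: (spectral_norm A) eta_le => a eta_le a0.
have b0 : 0 < mu ^+ 2 + a ^+ 2 by rewrite ltr_pwDl ?sqr_ge0 // exprn_gt0.
have ma : 0 <= mu + a by rewrite addr_ge0 // ltW.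
rewrite ler_pdivlMr //.
have -> : c * (eta^-1 + mu + a) * eta = c * (1 + eta * (mu + a)).
  by field; rewrite gt_eqF.
have H1 : c * (1 + eta * (mu + a)) <= c * (1 + mu * (mu + a) / (mu ^+ 2 + a ^+ 2)).
  by rewrite ler_pM2l // lerD2l mulrAC ler_wpM2r.
have p1 : 0 <= mu / (mu ^+ 2 + a ^+ 2) by rewrite divr_ge0 // ltW.
have p2 : 0 <= mu * a / (mu ^+ 2 + a ^+ 2) by rewrite mulrAC mulr_ge0.
apply: le_trans H1 _; set w := c * _; have w0 : 0 <= w.
  by apply: mulr_ge0; [exact: ltW|rewrite addr_ge0 // mulrAC mulr_ge0].
apply: le_trans (_ : _ <= mu / (mu ^+ 2 + a ^+ 2) + w) _; first by rewrite lerDr.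
by apply: ler_peMr; rewrite ?addr_ge0 // lerDl.
Qed.

Lemma beta_mu_gt0 (R : realType) m n (A : 'M[R]_(m, n)) (mu c : R) :
  0 < mu -> 0 < c -> 0 < beta_mu A mu c.
Proof.
move=> mu0 c0; rewrite /beta_mu; have a0 := spectral_norm_ge0 A.
have b0 : 0 < mu ^+ 2 + spectral_norm A ^+ 2.
  by rewrite ltr_pwDl ?sqr_ge0 // exprn_gt0.
have q0 u : 0 <= u -> 0 <= mu * u / (mu ^+ 2 + spectral_norm A ^+ 2).
  by move=> u0; rewrite divr_ge0 ?mulr_ge0 // ltW.
rewrite mulr_gt0 // ?ltr_pwDl ?q0 //; first exact: divr_gt0.
by rewrite mulr_ge0 ?ltW // ltr_pwDl ?q0 // addr_ge0 // ltW.
Qed.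

(** One step contracts the distance to the solution set: with Delta the step,
    D(z')^2 <= D(z)^2 - |Delta|^2 / 2 by the descent inequality at the point of
    Z_mu nearest to z, while D(z') <= (beta / eta) |Delta| by the error bound. *)
Lemma gda_step_contraction (R : realType) m n (A : 'M[R]_(m, n))
    (X : set 'cV[R]_m) (Y : set 'cV[R]_n) (mu eta c : R) (x x' : 'cV[R]_m)
    (y y' : 'cV[R]_n) :
    convex_body X -> convex_body Y -> 0 < mu -> 0 < c -> 0 < eta ->
    eta <= mu / (mu ^+ 2 + spectral_norm A ^+ 2) ->
    (forall z v, prod_set X Y z -> normal_cone (prod_set X Y) z v ->
       dist z (Z_mu A X Y mu) <= c * enorm (F_mu A mu z + v)) ->
    x' = Defs.proj X (x - eta *: (A *m y + mu *: x)) ->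
    y' = Defs.proj Y (y + eta *: (A^T *m x')) ->
  dist (col_mx x' y') (Z_mu A X Y mu) ^+ 2 <=
    1 / (1 + eta ^+ 2 / (2 * beta_mu A mu c ^+ 2))
    * dist (col_mx x y) (Z_mu A X Y mu) ^+ 2.
Proof.
move=> hX hY mu0 c0 eta0 eta_le err x'E y'E.
have Zz : prod_set X Y (col_mx x' y').
  exists x'; first by rewrite x'E; exact: convex_body_proj.
  by exists y' => //; rewrite y'E; exact: convex_body_proj.
have [v nv res] := gda_step_residual hX hY mu0 eta0 x'E y'E.
have {nv} errz := err _ _ Zz nv.
have [_ /(xgetI 0) [[xs xsE [ys Ys zE]] _]] := Z_mu_nearest A (col_mx x y) hX hY mu0.
have sad : saddle A X Y mu xs ys by rewrite xsE; exact/(Y_muP A ys hX hY mu0).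
have := gda_step_descent hX hY mu0 eta0 eta_le sad x'E y'E.
rewrite {2}zE -[xget _ _]/(Defs.proj (Z_mu A X Y mu) (col_mx x y)).
rewrite -[enorm (_ - Defs.proj _ _)]/(dist _ _) => desc.
have {}desc : dist (col_mx x' y') (Z_mu A X Y mu) ^+ 2 <=
    dist (col_mx x y) (Z_mu A X Y mu) ^+ 2 - 1 / 2 * enorm (col_mx x' y' - col_mx x y) ^+ 2.
  apply: le_trans desc; rewrite ler_pXn2r ?nnegrE ?enorm_ge0 //.
  apply: dist_le; first exact: Z_mu_nearest.
  by exists xs => //; exists ys.
have beta0 := beta_mu_gt0 A mu0 c0.
have be : dist (col_mx x' y') (Z_mu A X Y mu) <=
    beta_mu A mu c / eta * enorm (col_mx x' y' - col_mx x y).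
  apply: le_trans errz _.
  apply: le_trans (_ : _ <= c * ((eta^-1 + mu + spectral_norm A) *
    enorm (col_mx x' y' - col_mx x y))) _; first by rewrite ler_pM2l.
  by rewrite mulrA ler_wpM2r ?enorm_ge0 // beta_mu_ge.
move: desc be; have := enorm_ge0 (col_mx x' y' - col_mx x y).
have : 0 <= dist (col_mx x' y') (Z_mu A X Y mu) by exact: enorm_ge0.
move: (enorm _) (dist _ _) (dist _ _) (beta_mu _ _ _) beta0 => D d d' b b0 d'0 D0 desc be.
have q0 : 0 < 1 + eta ^+ 2 / (2 * b ^+ 2).
  by rewrite ltr_pwDl // divr_ge0 ?sqr_ge0 // mulr_ge0 ?sqr_ge0.
rewrite mul1r ler_pdivlMl //.
have {}be : d' ^+ 2 * eta ^+ 2 <= b ^+ 2 * D ^+ 2.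
  have [eta_ge b_ge] := (ltW eta0, ltW b0).
  rewrite -!exprMn ler_pXn2r ?nnegrE ?mulr_ge0 //.
  by rewrite -ler_pdivlMr // mulrAC.
have {}be : eta ^+ 2 / (2 * b ^+ 2) * d' ^+ 2 <= 1 / 2 * D ^+ 2.
  rewrite mulrAC ler_pdivrMr ?mulr_gt0 ?exprn_gt0 //; lra.
rewrite mulrDl mul1r; lra.
Qed.

(* c_mu is a function of mu chosen before alpha, as it depends only on
   A, X, Y and mu.  The bound on mu is taken in the extended reals, where
   alpha / 0 = +oo, which covers X = {0}. *)
Theorem corollary4p2 (R : realType) (m n : nat) (A : 'M[R]_(m, n))
    (X : set 'cV[R]_m) (Y : set 'cV[R]_n)
    (hX : polytope X) (hY : polytope Y) (X0 : X !=set0) (Y0 : Y !=set0) :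
  exists c : R -> R,
  forall alpha mu : R,
    0 < alpha ->
    (forall x, X x ->
       alpha * dist x (minimax_set X Y (payoff A))
         <= max_over Y (fun y => payoff A x y)
            - minimax_value X Y (payoff A)) ->
    0 < mu ->
    (mu%:E < alpha%:E / (max_over X (fun x => enorm x))%:E)%E ->
    0 < c mu /\
    (forall z, prod_set X Y z ->
       dist z (Z_mu A X Y mu)
         <= c mu * min_over (normal_cone (prod_set X Y) z)
                            (fun v => enorm (F_mu A mu z + v))) /\
    0 < beta_mu A mu (c mu) /\
    forall eta : R,
      0 < eta -> eta <= mu / (mu ^+ 2 + spectral_norm A ^+ 2) ->
    forall (x : nat -> 'cV[R]_m) (y : nat -> 'cV[R]_n),
      X (x 1%N) -> Y (y 1%N) -> asymp_gda A X Y mu eta x y ->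
    exists xstar, minimax_set X Y (payoff A) xstar /\
      forall t : nat, (1 <= t)%N ->
        enorm (xstar - x t) ^+ 2
          <= (1 / (1 + eta ^+ 2 / (2 * beta_mu A mu (c mu) ^+ 2))) ^+ t.-1
             * dist (col_mx (x 1%N) (y 1%N)) (Z_mu A X Y mu) ^+ 2.
Proof.
have bX := polytope_convex_body hX X0; have bY := polytope_convex_body hY Y0.
have /choice [c Hc] : forall mu : R, exists c, 0 < mu -> 0 < c /\
    forall z v, prod_set X Y z -> normal_cone (prod_set X Y) z v ->
    dist z (Z_mu A X Y mu) <= c * enorm (F_mu A mu z + v).
  move=> mu; have [mu0|mu0] := ltP 0 mu; last by exists 0.
  by have [c c0 H] := perturbed_error_bound A hX hY X0 Y0 mu0; exists c.
exists c => alpha mu alpha0 growth mu0 mu_lt.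
have [c0 err] := Hc mu mu0; split=> //; split=> [z Zz|].
  rewrite mulrC -ler_pdivrMr //; apply: lb_le_inf.
    exists (enorm (F_mu A mu z + 0)), 0 => // z' _.
    by rewrite dotC dot0r.
  by move=> _ [v nv <-]; rewrite ler_pdivrMr // mulrC; exact: err.
split=> [|eta eta0 eta_le x y Xx1 Yy1 it]; first exact: beta_mu_gt0.
exists (x_mu A X Y mu); split; first exact: x_mu_minimax growth mu0 mu_lt.
have xdist t : enorm (x_mu A X Y mu - x t) <= dist (col_mx (x t) (y t)) (Z_mu A X Y mu).
  have [_ /(xgetI 0) [[xs xsE [ys Ys zE]] _]] :=
    Z_mu_nearest A (col_mx (x t) (y t)) bX bY mu0.
  rewrite /dist -[Defs.proj _ _]zE xsE opp_col_mx add_col_mx enormB.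
  exact: enorm_usub_le.
move=> t t1; apply: le_trans (_ : _ <= dist (col_mx (x t) (y t)) (Z_mu A X Y mu) ^+ 2) _.
  by rewrite ler_pXn2r ?nnegrE ?enorm_ge0.
case: t t1 => // t _ /=; elim: t => [|t IH]; first by rewrite expr0 mul1r.
have [xE yE] := it t.+1 isT.
apply: le_trans (gda_step_contraction bX bY mu0 c0 eta0 eta_le err xE yE) _.
rewrite [_ ^+ t.+1]exprS -[leRHS]mulrA; apply: ler_wpM2l => //.
by rewrite divr_ge0 // addr_ge0 // divr_ge0 ?sqr_ge0 // mulr_ge0 ?sqr_ge0.
Qed.
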